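(* For every $f\in C_b(\mathbb R^d)$, $p>1$, $t>s$ in $I$ and $x,y\in\mathbb R^d$ we have $$|(G(t,s)f)(x)|^p\le(G(t,s)|f|^p)(y)\exp\left(\frac{p\,|x-y|^2}{4(p-1)\eta_0(t-s)}\right).$$
   Context: Setting. $I$ is an open right halfline, and for $t\in I$, $(\mathcal A(t)\zeta)(x)=\mathrm{Tr}(Q(t)D^2\zeta(x))+\langle b(t,x),\nabla\zeta(x)\rangle$, $x\in\mathbb R^d$, where $Q=[q_{ij}]$ and $b=(b_1,\dots,b_d)$. Standing assumptions: (i) for some $\theta\in(0,1)$, $q_{ij}\in C^{\theta/2}_{\rm loc}(I)$ and $b_i\in C^{\theta/2,\theta}_{\rm loc}(I\times\mathbb R^d)$ (locally parabolic H\''older); (ii) $Q(t)$ is symmetric and there are $0<\eta_0<\Lambda$ with $\eta_0|\xi|^2\le\langle Q(t)\xi,\xi\rangle\le\Lambda|\xi|^2$ for all $t\in I$, $\xi\in\mathbb R^d$; (iii) there are a positive $\varphi\in C^2(\mathbb R^d)$ with $\varphi(x)\to+\infty$ as $|x|\to+\infty$ and constants $a,\gamma>0$ with $(\mathcal A(t)\varphi)(x)\le a-\gamma\varphi(x)$ for all $(t,x)\in I\times\mathbb R^d$; (iv) the first order spatial derivatives of $b_i$ exist and belong to $C^{\theta/2,\theta}_{\rm loc}(I\times\mathbb R^d)$, and there is $r_0<0$ with $\langle\nabla_xb(t,x)\xi,\xi\rangle\le r_0|\xi|^2$ for all $(t,x)\in I\times\mathbb R^d$, $\xi\in\mathbb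 R^d$. For $s\in I$ and $f\in C_b(\mathbb R^d)$, $G(\cdot,s)f\in C_b([s,+\infty)\times\mathbb R^d)\cap C^{1+\theta/2,2+\theta}_{\rm loc}((s,+\infty)\times\mathbb R^d)$ denotes the unique bounded classical solution of $D_tu=\mathcal A(t)u$ in $(s,+\infty)\times\mathbb R^d$, $u(s,\cdot)=f$. *)

(* Defs.v *)
From HB Require Import structures.
From mathcomp Require Import all_boot all_order all_algebra.
From mathcomp Require Import all_classical all_reals all_analysis.
Set Implicit Arguments.
Unset Strict Implicit.
Unset Printing Implicit Defensive.
Import Order.TTheory GRing.Theory Num.Theory.
Import numFieldNormedType.Exports.
Local Open Scope classical_set_scope.
Local Open Scope ring_scope.

Section Euclidean.
Context {R : realType} {d : nat}.
Implicit Types (x y xi : 'rV[R]_d) (A : 'M[R]_d) (f : 'rV[R]_d -> R).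

Definition dot x y : R := \sum_i x 0 i * y 0 i.

(* The library norm on 'rV[R]_d is the sup norm; this is the Euclidean one. *)
Definition enorm x : R := Num.sqrt (dot x x).

(* <A xi, xi>, where xi is read as a column vector. *)
Definition quad_form A xi : R := \sum_i \sum_j A i j * xi 0 j * xi 0 i.

Definition partial_derivable (i : 'I_d) f x : Prop :=
  derivable f x (delta_mx 0 i).

Definition partial (i : 'I_d) f x : R := 'D_(delta_mx 0 i) f x.

Definition grad f x : 'rV[R]_d := \row_i partial i f x.

Definition hess f x : 'M[R]_d := \matrix_(i, j) partial i (partial j f) x.

Definition is_C2 f : Prop :=
  [/\ continuous f,
      forall i x, partial_derivable i f x,
      forall i, continuous (partial i f),
      forall i j x, partial_derivable i (partial j f) x &
      forall i j, continuous (partial i (partial j f))].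

Definition is_Cb f : Prop := continuous f /\ bounded_fun f.

End Euclidean.

Section FunctionSpaces.
Context {R : realType} {d : nat}.
Implicit Types (theta : R) (J : set R) (u : R -> 'rV[R]_d -> R).

(* C^alpha_loc(J) *)
Definition holder_loc (alpha : R) J (q : R -> R) : Prop :=
  forall K : set R, compact K -> K `<=` J ->
    exists C : R, forall t s, K t -> K s ->
      `|q t - q s| <= C * `|t - s| `^ alpha.

(* C^{theta/2,theta}_loc(J x R^d) *)
Definition par_holder_loc theta J u : Prop :=
  forall K : set (R * 'rV[R]_d), compact K -> K `<=` J `*` setT ->
    exists C : R, forall z w, K z -> K w ->
      `|u z.1 z.2 - u w.1 w.2| <=
        C * (`|z.1 - w.1| `^ (theta / 2) + enorm (z.2 - w.2) `^ theta).

Definition dt u (t : R) (x : 'rV[R]_d) : R := derive1 (fun r => u r x) t.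

(* C^{1+theta/2,2+theta}_loc(J x R^d), for J open *)
Definition par_C12_holder_loc theta J u : Prop :=
  [/\ forall t x, J t -> derivable (fun r => u r x) t 1,
      forall i t x, J t -> partial_derivable i (u t) x &
      forall i j t x, J t -> partial_derivable i (partial j (u t)) x] /\
  [/\ par_holder_loc theta J u,
      par_holder_loc theta J (dt u),
      forall i, par_holder_loc theta J (fun t => partial i (u t)) &
      forall i j, par_holder_loc theta J (fun t => partial i (partial j (u t)))].

End FunctionSpaces.

Section Equation.
Context {R : realType} {d : nat}.
Implicit Types (theta : R) (I : set R) (Q : R -> 'M[R]_d).
Implicit Types (b : R -> 'rV[R]_d -> 'rV[R]_d).

Definition open_right_halfline I : Prop := exists l : R, I = `]l, +oo[%classic.

Definition elliptic_op Q b (t : R) (zeta : 'rV[R]_d -> R) (x : 'rV[R]_d) : R :=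
  \tr (Q t *m hess zeta x) + dot (b t x) (grad zeta x).

(* Row i of nabla_x b is the gradient of b_i. *)
Definition jac b (t : R) (x : 'rV[R]_d) : 'M[R]_d :=
  \matrix_(i, j) partial j (fun y => b t y 0 i) x.

Definition bounded_classical_solution theta Q b (s : R) (f : 'rV[R]_d -> R)
    (u : R -> 'rV[R]_d -> R) : Prop :=
  let D := [set z : R * 'rV[R]_d | s <= z.1] in
  [/\ {within D, continuous (fun z => u z.1 z.2)},
      [bounded u z.1 z.2 | z in D],
      par_C12_holder_loc theta `]s, +oo[%classic u,
      forall t x, s < t -> dt u t x = elliptic_op Q b t (u t) x &
      forall x, u s x = f x].

(* G t s f x stands for (G(t,s)f)(x).  Under the standing assumptions on Q and
   b there is exactly one such solution for each s and f, so G t s f is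
   determined for s in I, t >= s and f bounded continuous. *)
Definition evolution_operator theta I Q b
    (G : R -> R -> ('rV[R]_d -> R) -> 'rV[R]_d -> R) : Prop :=
  forall s f, I s -> is_Cb f ->
    bounded_classical_solution theta Q b s f (fun t => G t s f).

Definition hyp_regular theta I Q b : Prop :=
  (forall i j, holder_loc (theta / 2) I (fun t => Q t i j)) /\
  (forall i, par_holder_loc theta I (fun t x => b t x 0 i)).

Definition hyp_elliptic (eta0 Lambda : R) I Q : Prop :=
  forall t, I t -> (Q t)^T = Q t /\
    forall xi, eta0 * enorm xi ^+ 2 <= quad_form (Q t) xi
               /\ quad_form (Q t) xi <= Lambda * enorm xi ^+ 2.

Definition hyp_lyapunov (phi : 'rV[R]_d -> R) (a gamma : R) I Q b : Prop :=
  [/\ is_C2 phi,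
      forall x, 0 < phi x,
      forall M : R, exists r : R, forall x, r < enorm x -> M < phi x &
      forall t x, I t -> elliptic_op Q b t phi x <= a - gamma * phi x].

Definition hyp_dissipative theta (r0 : R) I b : Prop :=
  [/\ forall i j t x, I t -> partial_derivable j (fun y => b t y 0 i) x,
      forall i j, par_holder_loc theta I
        (fun t => partial j (fun y => b t y 0 i)) &
      forall t x xi, I t -> quad_form (jac b t x) xi <= r0 * enorm xi ^+ 2].

End Equation.

(* Main.v *)
Require Import Defs.
From HB Require Import structures.
From mathcomp Require Import all_boot all_order all_algebra.
From mathcomp Require Import all_classical all_reals all_analysis.
From mathcomp Require Import ring lra.
Set Implicit Arguments.
Unset Strict Implicit.
Unset Printing Implicit Defensive.
Import Order.TTheory GRing.Theory Num.Theory.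
Import numFieldNormedType.Exports.
Local Open Scope classical_set_scope.
Local Open Scope ring_scope.

(** The inequality compares the two solutions [u = G(., s) f] and
    [v = G(., s) |f|^p] at different points, so it is proved by a maximum principle
    in the doubled variables [(t, x, y)]. Where [u > 0], the functions [p ln u]
    and [ln v] satisfy [D_t w = A(t) w + sigma <Q grad w, grad w>] with
    [sigma = 1/p] and [sigma = 1] (quasilinear_ln). Consider

      [W (t, x, y) = p ln u (t, x) - ln v (t, y) - c |x - y| ^ 2 / (t - s)].

    It must not become positive. At an interior maximum both gradients equal
    [xi = 2 c (x - y) / (t - s)]. Moving [x] and [y] by the same vector does not
    change [|x - y|], so the Hessian of [p ln u] at [x] is at most that of [ln v] at
    [y], and the second-order terms have the good sign because [Q] does not depend
    on [x]. The drift contributes [<b(t, x) - b(t, y), xi> <= 0] by dissipativity.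
    What remains is

      [(1/p - 1) <Q xi, xi> + c |x - y| ^ 2 / (t - s) ^ 2],

    which is nonpositive as soon as [4 c eta0 (1 - 1/p) >= 1]; the smallest such
    [c] is [p / (4 (p - 1) eta0)], and the exponent of the theorem is
    [c |x - y| ^ 2 / (t - s)].

    To make this rigorous, the maximum is forced to exist by subtracting
    [eps (|x| ^ 2 + |y| ^ 2)]. The resulting errors of order [eps] are paid by a
    term [eps K (t - s)] and those of order [eps ^ 2 |x| ^ 2] by the coercivity
    [<b(t, x), x> <= B - beta |x| ^ 2], again a consequence of dissipativity; the
    cross terms between [xi] and [eps x] cost an arbitrarily small part of [c]
    (doubling_gap, doubling_comparison). The singularity of the penalty at
    [t = s] is removed by replacing [t - s] with [t - s + delta], and
    penalized_diff_small shows that the initial value of [W] is then at most an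
    arbitrarily small constant.
    Logarithms are regularised at a level [eta] (regularised_harnack). The same
    comparison lemma with [c = 0] gives [v >= 0] (solution_ge0), and applying the
    estimate to [u] and to [- u] gives the absolute value. *)

(** * Euclidean products, quadratic forms and traces *)

Section LinearAlgebra.
Context {R : realType}.

Lemma enorm_sqr d (x : 'rV[R]_d) : enorm x ^+ 2 = dot x x.
Proof. by rewrite sqr_sqrtr // sumr_ge0 // => i _; rewrite -expr2 sqr_ge0. Qed.

Lemma dotC d (x y : 'rV[R]_d) : dot x y = dot y x.
Proof. by apply: eq_bigr => i _; rewrite mulrC. Qed.

Lemma dotDr d (x y z : 'rV[R]_d) : dot x (y + z) = dot x y + dot x z.
Proof. by rewrite -big_split; apply: eq_bigr => i _; rewrite mxE mulrDr. Qed.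

Lemma dotZr d k (x y : 'rV[R]_d) : dot x (k *: y) = k * dot x y.
Proof. by rewrite mulr_sumr; apply: eq_bigr => i _; rewrite mxE mulrCA. Qed.

Lemma dotNr d (x y : 'rV[R]_d) : dot x (- y) = - dot x y.
Proof. by rewrite -scaleN1r dotZr mulN1r. Qed.

Lemma dotDl d (x y z : 'rV[R]_d) : dot (y + z) x = dot y x + dot z x.
Proof. by rewrite !(dotC _ x) dotDr. Qed.

Lemma dotZl d k (x y : 'rV[R]_d) : dot (k *: y) x = k * dot y x.
Proof. by rewrite !(dotC _ x) dotZr. Qed.

Lemma dotNl d (x y : 'rV[R]_d) : dot (- y) x = - dot y x.
Proof. by rewrite !(dotC _ x) dotNr. Qed.

Lemma dot0l d (x : 'rV[R]_d) : dot 0 x = 0.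
Proof. by rewrite -(scale0r x) dotZl mul0r. Qed.

Lemma dot_ge0 d (x : 'rV[R]_d) : 0 <= dot x x.
Proof. by rewrite -enorm_sqr sqr_ge0. Qed.

Lemma coord_sqr_le_dot d (x : 'rV[R]_d) i : x 0 i ^+ 2 <= dot x x.
Proof.
rewrite /dot (bigD1 i) //= -expr2 lerDl sumr_ge0 // => j _.
by rewrite -expr2 sqr_ge0.
Qed.

Lemma dot_gt0 d (x : 'rV[R]_d) : x != 0 -> 0 < dot x x.
Proof.
move=> x0; rewrite lt_neqAle dot_ge0 andbT eq_sym; apply: contra x0 => /eqP x0.
apply/eqP/rowP => i; rewrite mxE; apply/eqP.
by rewrite -sqrf_eq0 eq_le sqr_ge0 andbT -x0 coord_sqr_le_dot.
Qed.

Lemma dot_inj d (g g' : 'rV[R]_d) : (forall e, dot e g = dot e g') -> g = g'.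
Proof.
move=> H; apply/rowP => i; have := H (delta_mx 0 i).
have E (z : 'rV[R]_d) : dot (delta_mx 0 i) z = z 0 i.
  rewrite /dot (bigD1 i) //= big1 ?addr0 ?mxE ?eqxx ?mul1r // => j ji.
  by rewrite mxE (negPf ji) andbF mul0r.
by rewrite !E.
Qed.

Lemma quad_form_mx d (A : 'M[R]_d) x : quad_form A x = (x *m A *m x^T) 0 0.
Proof.
rewrite mxE /quad_form exchange_big; apply: eq_bigr => j _.
rewrite !mxE mulr_suml; apply: eq_bigr => i _; ring.
Qed.

Lemma quad_form_scale_add d (A : 'M[R]_d) (k : R) x y : quad_form A (k *: x + y) =
  k ^+ 2 * quad_form A x + quad_form A y
    + k * \sum_i \sum_j A i j * (x 0 j * y 0 i + y 0 j * x 0 i).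
Proof.
rewrite /quad_form !mulr_sumr -!big_split /=; apply: eq_bigr => i _.
rewrite !mulr_sumr -!big_split /=; apply: eq_bigr => j _.
by rewrite !mxE; ring.
Qed.

Lemma quad_form_scale d (A : 'M[R]_d) k x :
  quad_form A (k *: x) = k ^+ 2 * quad_form A x.
Proof.
rewrite /quad_form mulr_sumr; apply: eq_bigr => i _.
rewrite mulr_sumr; apply: eq_bigr => j _; rewrite !mxE; ring.
Qed.

Lemma quad_form_add d (A B : 'M[R]_d) x :
  quad_form (A + B) x = quad_form A x + quad_form B x.
Proof. by rewrite !quad_form_mx mulmxDr mulmxDl mxE. Qed.

Lemma quad_form_opp d (A : 'M[R]_d) x : quad_form (- A) x = - quad_form A x.
Proof. by rewrite !quad_form_mx mulmxN mulNmx mxE. Qed.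

Lemma quad_form_scale_mx d (A : 'M[R]_d) (k : R) x :
  quad_form (k *: A) x = k * quad_form A x.
Proof. by rewrite !quad_form_mx -scalemxAr -scalemxAl mxE. Qed.

Lemma quad_form_rank1 d (g x : 'rV[R]_d) :
  quad_form (g^T *m g) x = dot x g ^+ 2.
Proof.
rewrite quad_form_mx mulmxA -mulmxA mxE big_ord1 !mxE expr2; congr (_ * _).
  by apply: eq_bigr => i _; rewrite mxE.
by rewrite dotC; apply: eq_bigr => i _; rewrite mxE.
Qed.

Lemma quad_form_scalar d k (x : 'rV[R]_d) : quad_form k%:M x = k * dot x x.
Proof.
rewrite quad_form_mx mul_mx_scalar -scalemxAl mxE; congr (_ * _).
by rewrite mxE; apply: eq_bigr => i _; rewrite !mxE.
Qed.

(** Weighted Young inequality for the cross term, obtained by expanding the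
    square [quad_form A (k *: x - y) >= 0]. *)
Lemma quad_form_young d (A : 'M[R]_d) (k : R) x y :
  (forall z, 0 <= quad_form A z) -> 0 < k ->
  quad_form A (x + y) <=
    (1 + k) * quad_form A x + (1 + k^-1) * quad_form A y.
Proof.
move=> A0 k0; have := A0 ((- k) *: x + y).
rewrite -[x in x + y]scale1r !quad_form_scale_add.
set S := \sum_i _; set qx := quad_form A x; set qy := quad_form A y => H.
have : 0 <= k^-1 * ((- k) ^+ 2 * qx + qy + - k * S).
  by rewrite mulr_ge0 // invr_ge0 ltW.
have -> : k^-1 * ((- k) ^+ 2 * qx + qy + - k * S) = k * qx + k^-1 * qy - S.
  by field; rewrite gt_eqF.
lra.
Qed.

Lemma quad_form_young_lower d (A : 'M[R]_d) (k : R) x y :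
  (forall z, 0 <= quad_form A z) -> 0 < k ->
  (1 - k) * quad_form A x + (1 - k^-1) * quad_form A y <=
    quad_form A (x + y).
Proof.
move=> A0 k0; have := A0 (k *: x + y).
rewrite -[x in x + y]scale1r !quad_form_scale_add.
set S := \sum_i _; set qx := quad_form A x; set qy := quad_form A y => H.
have : 0 <= k^-1 * (k ^+ 2 * qx + qy + k * S).
  by rewrite mulr_ge0 // invr_ge0 ltW.
have -> : k^-1 * (k ^+ 2 * qx + qy + k * S) = k * qx + k^-1 * qy + S.
  by field; rewrite gt_eqF.
lra.
Qed.

Lemma dot_young d (k : R) (x y : 'rV[R]_d) : 0 < k ->
  2 * dot x y <= k^-1 * dot x x + k * dot y y.
Proof.
move=> k0; have := dot_ge0 (x - k *: y).
rewrite !(dotDl, dotDr, dotNl, dotNr, dotZl, dotZr) (dotC y x) => H.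
have : 0 <= k^-1 * (dot x x - k * dot x y - (k * dot x y - k * (k * dot y y))).
  by apply: mulr_ge0; [rewrite invr_ge0 ltW | lra].
have -> : k^-1 * (dot x x - k * dot x y - (k * dot x y - k * (k * dot y y))) =
  k^-1 * dot x x + k * dot y y - 2 * dot x y by field; rewrite gt_eqF.
lra.
Qed.

(** A positive definite matrix is a sum of rank one matrices [w^T *m w], each of
    which contributes [quad_form H w] to the trace. The induction performs one
    step of the Cholesky factorisation: subtracting from [A] the rank one matrix
    built on its first row leaves the Schur complement, which is again positive
    definite. *)
Lemma mxtrace_mul_le0 d (A H : 'M[R]_d) : A^T = A ->
  (forall x, x != 0 -> 0 < quad_form A x) ->
  (forall x, quad_form H x <= 0) -> \tr (A *m H) <= 0.
Proof.
elim: d A H => [|d IH] A H; first by rewrite /mxtrace big_ord0.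
move: A H; rewrite -[d.+1]add1n => A H; move=> sA pA nH.
set a := A 0 0.
set v : 'rV[R]_d := ursubmx A.
set B : 'M[R]_d := drsubmx A.
have a0 : 0 < a.
  have : 0 < quad_form A (delta_mx 0 0).
    apply: pA; apply/eqP => /matrixP/(_ 0 0); rewrite !mxE !eqxx.
    by move/eqP; rewrite oner_eq0.
  by rewrite quad_form_mx trmx_delta -rowE -colE !mxE.
have aE : (a%:M : 'M[R]_1) = ulsubmx A.
  apply/matrixP => i j; rewrite !ord1 !mxE /= mulr1n; congr (A _ _).
    by apply/val_inj.
  by apply/val_inj.
have AE : A = block_mx a%:M v v^T B.
  rewrite aE -[LHS]submxK; congr block_mx.
  by rewrite /v trmx_ursub sA.
pose w : 'rV[R]_(1 + d) := row_mx a%:M v.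
pose B' := B - a^-1 *: (v^T *m v).
have A_split : A = a^-1 *: (w^T *m w) + block_mx 0 0 0 B'.
  rewrite AE /w tr_row_mx mul_col_row tr_scalar_mx scale_block_mx add_block_mx.
  rewrite !addr0 !mul_scalar_mx mul_mx_scalar scale_scalar_mx.
  rewrite !scalerA ?scale_scalar_mx ?mulrA mulVf ?gt_eqF // ?mul1r !scale1r /B'.
  by rewrite addrCA subrr addr0.
have trE : \tr (A *m H) = a^-1 * quad_form H w + \tr (B' *m drsubmx H).
  rewrite [in LHS]A_split mulmxDl mxtraceD -scalemxAl mxtraceZ.
  congr (_ * _ + _).
    by rewrite -mulmxA mxtrace_mulC quad_form_mx -trace_mx11.
  rewrite -[H in LHS]submxK mulmx_block mxtrace_block.
  by rewrite !mul0mx !addr0 mxtrace0 !add0r.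
rewrite trE; have Bs : B^T = B.
  by rewrite /B trmx_drsub sA.
rewrite -[leRHS]addr0; apply: lerD.
  by rewrite pmulr_rle0 ?invr_gt0.
apply: IH.
- by rewrite /B' linearB /= Bs linearZ /= trmx_mul trmxK.
- move=> z z0.
  (* [al] is the first coordinate minimising the quadratic form over the vectors
     whose other coordinates are [z]; the minimum is the Schur complement *)
  pose al : 'M[R]_1 := - a^-1 *: (z *m v^T).
  have : 0 < quad_form A (row_mx al z).
    apply: pA; apply: contra z0 => /eqP.
    by rewrite -[X in _ = X]row_mx0 => /eq_row_mx[_ /eqP].
  have -> : quad_form A (row_mx al z) = quad_form B' z; last by [].
  rewrite !quad_form_mx AE mul_row_block tr_row_mx mul_row_col.
  congr (fun_of_matrix _ 0 0).
  have -> : al *m a%:M + z *m v^T = 0.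
    by rewrite mul_mx_scalar /al scalerA mulrN mulfV ?gt_eqF // scaleN1r addNr.
  rewrite mul0mx add0r; congr (_ *m _).
  rewrite /al /B' mulmxBr addrC -scalemxAl scaleNr; congr (_ - _).
  by rewrite -scalemxAr mulmxA.
- move=> z; have := nH (row_mx 0 z); rewrite !quad_form_mx.
  rewrite -[H in X in X -> _]submxK mul_row_block tr_row_mx mul_row_col.
  by rewrite !mul0mx trmx0 mulmx0 !add0r.
Qed.

Lemma mxtrace_le d (A : 'M[R]_d) c :
  (forall x, quad_form A x <= c * enorm x ^+ 2) -> \tr A <= d%:R * c.
Proof.
move=> hA; have -> : d%:R * c = \sum_(i < d) c.
  by rewrite sumr_const card_ord mulr_natl.
apply: ler_sum => i _; have := hA (delta_mx 0 i).
rewrite enorm_sqr quad_form_mx trmx_delta -rowE -colE !mxE.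
rewrite /dot (bigD1 i) //= big1 ?addr0 ?mxE ?eqxx ?mulr1 //.
by move=> j ji; rewrite !mxE (negPf ji) andbF mulr0.
Qed.

End LinearAlgebra.

(** * Derivatives along lines *)

Section DirectionalCalculus.
Context {R : realType}.

Lemma is_derive_continuous (f : R -> R) (x l : R) :
  is_derive x 1 f l -> {for x, continuous f}.
Proof.
by move=> [df _]; apply: differentiable_continuous; apply/derivable1_diffP.
Qed.

Lemma is_derive_lineP (V : normedModType R) (F : V -> R) x e (h D : R) :
  is_derive (x + h *: e) e F D <-> is_derive h 1 (fun k => F (x + k *: e)) D.
Proof.
have E : (fun k : R => k^-1 *: (F (x + (k *: 1 + h) *: e) - F (x + h *: e))) =
         (fun k : R => k^-1 *: (F (k *: e + (x + h *: e)) - F (x + h *: e))).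
  apply/funext => k; congr (_ *: (F _ - _)).
  by rewrite scalerDl -[k *: 1]/(k * 1) mulr1 addrCA.
split=> -[dF <-]; split.
- by rewrite /derivable /= E.
- by rewrite /derive /= E.
- by move: dF; rewrite /derivable /= E.
- by rewrite /derive /= E.
Qed.

Lemma is_derive_line (V : normedModType R) (F : V -> R) x e (h D : R) :
  is_derive (x + h *: e) e F D -> is_derive h 1 (fun k => F (x + k *: e)) D.
Proof. by move/is_derive_lineP. Qed.

Lemma is_derive_scale_dir (V : normedModType R) (F : V -> R) x e (k : R) :
  derivable F x e -> is_derive x (k *: e) F (k * 'D_e F x).
Proof.
move=> dF.
have dl : is_derive (k * 0) 1 (fun t => F (x + t *: e)) ('D_e F x).
  by apply: is_derive_line; rewrite mulr0 scale0r addr0; exact: derivableP.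
have dk : is_derive (0 : R) 1 (fun t : R => k * t) k.
  have := is_deriveZ (f := @id R) k (is_derive_id (0 : R) 1).
  by rewrite /GRing.scale /= mulr1.
have := is_derive1_comp dl dk; rewrite mulrC.
have -> : (fun t => F (x + t *: e)) \o (fun t => k * t) =
    (fun t : R => F (x + t *: (k *: e))).
  by apply/funext => t /=; rewrite scalerA mulrC.
by move/is_derive_lineP; rewrite scale0r addr0.
Qed.

(** Moving first along [e], then along [e']: the mean value theorem writes the
    second increment as a value of ['D_e' F] at a nearby point, so continuity of
    that one directional derivative suffices. *)
Lemma is_derive_add_dir (V : normedModType R) (F : V -> R) x e e' :
  derivable F x e -> (forall z, derivable F z e') -> continuous ('D_e' F) ->
  is_derive x (e + e') F ('D_e F x + 'D_e' F x).
Proof.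
move=> dF dF' cF'.
suff H : (fun h : R => h^-1 *: (F (h *: (e + e') + x) - F x)) @ 0^' -->
    'D_e F x + 'D_e' F x.
  by apply: DeriveDef; [apply/cvg_ex; exists ('D_e F x + 'D_e' F x) |
     apply: cvg_lim].
have -> : (fun h : R => h^-1 *: (F (h *: (e + e') + x) - F x)) =
  (fun h => h^-1 *: (F (h *: e + x) - F x)) +
  (fun h => h^-1 *: (F (h *: e' + (h *: e + x)) - F (h *: e + x))).
  apply/funext => h; rewrite fctE -scalerDr; congr (_ *: _).
  by rewrite scalerDr [h *: e + _]addrC -addrA [RHS]addrC [RHS]addrA subrK.
apply: cvgD; first exact: dF.
apply/cvgrPdist_le => /= eps eps0.
have /cvgrPdist_le/(_ _ eps0) := cF' x.
case/nbhs_ballP => r /= r0 Hr.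
have c0 : (fun h : R => `|h| * (`|e| + `|e'|)) @ 0^' -->
    (`|0 : R| * (`|e| + `|e'|)).
  by apply: cvg_within_filter; apply: cvgMl; apply: cvg_norm; exact: cvg_id.
have := c0; move/cvgrPdist_lt/(_ _ r0).
move=> Hs.
near=> h.
have h0 : h != 0 by near: h; exact: nbhs_dnbhs_neq.
have hr : `|h| * (`|e| + `|e'|) < r.
  have : `| `|0 : R| * (`|e| + `|e'|) - `|h| * (`|e| + `|e'|) | < r.
    by near: h; exact: Hs.
  by rewrite normr0 mul0r sub0r normrN ger0_norm // mulr_ge0 // addr_ge0.
pose g (k : R) := F ((h *: e + x) + k *: e').
have dg (k : R) : is_derive k 1 g ('D_e' F ((h *: e + x) + k *: e')).
  by apply: is_derive_line; exact: derivableP.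
have cg : continuous g.
  by move=> k; exact: is_derive_continuous (dg k).
have [c ch gE] : exists2 c, `|c| <= `|h| &
    g h - g 0 = 'D_e' F ((h *: e + x) + c *: e') * h.
  have [hp|hn|hz] := ltgtP 0 h; last by rewrite hz eqxx in h0.
  - have [c] := MVT hp (fun k _ => dg k) (continuous_subspaceT cg).
    rewrite in_itv /= subr0 => /andP[c0' ch] ->; exists c => //.
    by rewrite !gtr0_norm // ltW.
  - have [c] := MVT hn (fun k _ => dg k) (continuous_subspaceT cg).
    rewrite in_itv /= sub0r => /andP[hc cn] E; exists c.
      by rewrite !ltr0_norm // lerN2 ltW.
    by apply: oppr_inj; rewrite opprB E mulrN.
have -> : h^-1 *: (F (h *: e' + (h *: e + x)) - F (h *: e + x)) =
    'D_e' F ((h *: e + x) + c *: e').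
  rewrite [h *: e' + _]addrC -/(g h).
  have -> : F (h *: e + x) = g 0 by rewrite /g scale0r addr0.
  by rewrite gE -[_ *: _]/(_ * _) mulrC mulfK.
apply: Hr; rewrite -ball_normE /=.
rewrite [h *: e + x + _]addrAC opprD addrCA subrr addr0 normrN.
apply: le_lt_trans hr; rewrite mulrDr (le_trans (ler_normD _ _)) //.
by rewrite !normrZ lerD // ler_wpM2r.
Unshelve. all: by end_near.
Qed.

End DirectionalCalculus.

Section SecondOrder.
Context {R : realType}.

(** Continuous partial derivatives give all directional derivatives, by adding
    the coordinates of the direction one at a time. *)
Lemma is_derive_grad d (F : 'rV[R]_d -> R) x e :
  (forall i z, partial_derivable i F z) ->
  (forall i, continuous (partial i F)) ->
  is_derive x e F (dot e (grad F x)).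
Proof.
move=> dF cF; rewrite {1}(row_sum_delta e).
have -> : dot e (grad F x) = \sum_i e 0 i * partial i F x.
  by apply: eq_bigr => i _; rewrite mxE.
elim: (index_enum _) x => [|i r IH] x; rewrite ?big_nil ?big_cons.
  exact: is_derive0.
have dF' z : is_derive z (e 0 i *: delta_mx 0 i) F (e 0 i * partial i F z).
  exact: (is_derive_scale_dir (e 0 i) (dF i z)).
have dIH := IH x.
rewrite addrC [X in is_derive _ _ _ X]addrC.
rewrite -(@derive_val _ _ _ _ _ _ _ dIH) -(@derive_val _ _ _ _ _ _ _ (dF' x)).
apply: is_derive_add_dir => //.
have -> : 'D_(e 0 i *: delta_mx 0 i) F = (fun z => e 0 i * partial i F z).
  by apply/funext => z; rewrite (@derive_val _ _ _ _ _ _ _ (dF' z)).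
suff H (c : R) : continuous (fun z => c * partial i F z) by exact: H.
by move=> z; exact: (cvgMr (cF i z)).
Qed.

(** The second-order data of a function of one variable at the origin. The
    derivative [g'] is only required near the origin, so that the notion is
    local and passes to logarithms of functions that are positive at 0. *)
Definition jet2 (g : R -> R) (a b : R) := exists2 g' : R -> R,
  (\forall h \near (0 : R), is_derive (h : R) 1 g (g' h)) &
  g' 0 = a /\ is_derive (0 : R) 1 g' b.

Lemma jet2_eq g a b a' b' : a = a' -> b = b' -> jet2 g a b -> jet2 g a' b'.
Proof. by move=> -> ->. Qed.

Lemma jet2_add f g a b a' b' :
  jet2 f a b -> jet2 g a' b' -> jet2 (f \+ g) (a + a') (b + b').
Proof.
move=> [f' df [<- ddf]] [g' dg [<- ddg]]; exists (f' \+ g').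
  by near=> h; apply: is_deriveD; near: h.
by split => //; exact: is_deriveD.
Unshelve. all: by end_near.
Qed.

Lemma jet2_scale k g a b : jet2 g a b -> jet2 (fun h => k * g h) (k * a) (k * b).
Proof.
move=> [g' dg [<- ddg]]; exists (fun h => k * g' h).
  by near=> h; apply: (is_deriveZ (f := g)); near: h.
by split => //; exact: (is_deriveZ (f := g')).
Unshelve. all: by end_near.
Qed.

Lemma jet2_quadratic (al be ga : R) :
  jet2 (fun h => al + h * be + h ^+ 2 * ga) be (2 * ga).
Proof.
have lin (k h : R) : is_derive h 1 (fun h : R => h * k) k.
  have := is_deriveZ (f := @id R) k (is_derive_id h 1).
  rewrite /GRing.scale /= mulr1; congr is_derive.
  by apply/funext => t; rewrite /= mulrC.
exists (fun h => be + h * (2 * ga)).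
  near=> h.
  have sq : is_derive h 1 (fun h : R => h ^+ 2 * ga) (h * (2 * ga)).
    have -> : (fun h : R => h ^+ 2 * ga) = (fun h => h * ga) * @id R.
      by apply/funext => t; rewrite fctE /=; ring.
    apply: (is_derive_eq (is_deriveM (lin ga h) (is_derive_id h 1))).
    by rewrite /GRing.scale /=; ring.
  have := is_deriveD (is_deriveD (is_derive_cst al h 1) (lin be h)) sq.
  by rewrite add0r.
split; first by rewrite mul0r addr0.
have := is_deriveD (is_derive_cst be (0 : R) 1) (lin (2 * ga) 0).
by rewrite add0r.
Unshelve. all: by end_near.
Qed.

Lemma jet2_ln g a b : 0 < g 0 -> jet2 g a b ->
  jet2 (fun h => ln (g h)) (a / g 0) (b / g 0 - (a / g 0) ^+ 2).
Proof.
move=> g0 [g' dg [g'0 ddg]].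
have dg0 : is_derive (0 : R) 1 g (g' 0) by exact: nbhs_singleton dg.
have cg : {for 0, continuous g}.
  exact: is_derive_continuous dg0.
exists (fun h => (g h)^-1 * g' h).
  near=> h.
  have gh : 0 < g h by near: h; exact: (cvgr_gt (g 0)).
  have dh : is_derive h 1 g (g' h) by near: h.
  have dl := is_derive1_ln gh.
  exact: is_derive1_comp.
split; first by rewrite g'0 mulrC.
have dV : is_derive (0 : R) 1 (fun h => (g h)^-1) (- (g 0) ^- 2 * g' 0).
  apply: DeriveDef; first by apply: derivableV => //; rewrite gt_eqF.
  by rewrite deriveV ?gt_eqF // derive_val.
apply: (is_derive_eq (is_deriveM dV ddg)).
by rewrite /GRing.scale /= g'0; field; rewrite gt_eqF.
Unshelve. all: by end_near.
Qed.

Lemma jet2_max g a b : (forall h, g h <= g 0) -> jet2 g a b -> a = 0 /\ b <= 0.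
Proof.
move=> gmax [g' dg [<- ddg]].
have /nbhs_ballP[r /= r0 Hr] := dg.
have inr h : h \in `]-r, r[ -> is_derive h 1 g (g' h).
  rewrite in_itv /= => hr; apply: Hr; rewrite -ball_normE /= sub0r normrN.
  by rewrite ltr_norml.
have g'0 : g' 0 = 0.
  have i0 : (0 : R) \in `]-r, r[ by rewrite in_itv /= oppr_lt0 r0.
  have H : is_derive (0 : R) 1 g 0.
    apply: (@derive1_at_max _ g (- r) r) => //; first by lra.
    by move=> t /inr.
  by rewrite -(@derive_val _ _ _ _ _ _ _ (inr _ i0)) derive_val.
(* if [b > 0] then [g' > 0] on some [(0, h]], so [g] increases there *)
split=> //; rewrite leNgt; apply/negP => b0.
have [dd E] := ddg.
have : (fun h : R => h^-1 *: (g' (h *: 1 + 0) - g' 0)) @ 0^' --> b.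
  by rewrite -E; exact: dd.
move=> /cvgrPdist_lt/(_ _ b0) [s /= s0 Hs].
pose h := Num.min r s / 2.
have h0 : 0 < h by rewrite /h divr_gt0 // lt_min r0.
have m0 : 0 < Num.min r s by rewrite lt_min r0.
have hr : h < r.
  by rewrite /h; have : Num.min r s <= r by [rewrite ge_min lexx]; lra.
have hs : h < s.
  by rewrite /h; have : Num.min r s <= s by [rewrite ge_min lexx orbT]; lra.
have pos k : 0 < k -> k <= h -> 0 < g' k.
  move=> k0 kh; have := Hs k; rewrite /= sub0r normrN gtr0_norm //.
  move=> /(_ (le_lt_trans kh hs))/(_ (lt0r_neq0 k0)).
  rewrite g'0 subr0 addr0 /GRing.scale /= mulr1 => /ltr_normlP[_].
  rewrite ltrBlDr -{1}[b]addr0 ltrD2l.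
  by rewrite pmulr_rgt0 ?invr_gt0.
have ig k : k \in `]0, h[ -> is_derive k 1 g (g' k).
  rewrite in_itv /= => /andP[k0 kh]; apply: inr; rewrite in_itv /=.
  by apply/andP; split; lra.
have [|c] := MVT h0 ig.
  apply: derivable_within_continuous => k; rewrite in_itv /= => /andP[k0 kh].
  suff : is_derive k 1 g (g' k) by [].
  by apply: inr; rewrite in_itv /=; apply/andP; split; lra.
rewrite in_itv /= subr0 => /andP[c0 ch] E'.
have := gmax h; rewrite -subr_le0 E' leNgt mulr_gt0 //.
by apply: pos => //; exact: ltW.
Qed.

(** The gradient expansion applied twice, to [F] and to its partial derivatives. *)
Lemma jet2_line d (F : 'rV[R]_d -> R) x e : is_C2 F ->
  jet2 (fun h => F (x + h *: e)) (dot e (grad F x)) (quad_form (hess F x) e).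
Proof.
move=> [cF dF cdF ddF cddF].
exists (fun h => dot e (grad F (x + h *: e))).
  by near=> h; apply: is_derive_line; exact: is_derive_grad.
split; first by rewrite scale0r addr0.
have -> : (fun h => dot e (grad F (x + h *: e))) =
    \sum_i (fun h => e 0 i * partial i F (x + h *: e)).
  by apply/funext => h; rewrite fct_sumE; apply: eq_bigr => i _; rewrite mxE.
apply: (@is_derive_eq _ _ _ _ _ _ _ (\sum_i e 0 i * dot e (grad (partial i F) x))).
  apply: is_derive_sum => i.
  have H : is_derive (0 : R) 1 (fun h => partial i F (x + h *: e))
      (dot e (grad (partial i F) x)).
    by apply: is_derive_line; rewrite scale0r addr0; exact: is_derive_grad.
  exact: (is_deriveZ (e 0 i) H).
rewrite /quad_form exchange_big; apply: eq_bigr => j _.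
rewrite /dot mulr_sumr; apply: eq_bigr => i _; rewrite !mxE; ring.
Unshelve. all: by end_near.
Qed.

End SecondOrder.

(** * The penalised function: continuity, time derivative, maximum *)

Section Continuity.
Context {R : realType}.

(** Over an abstract topological type, so that it applies as it stands to spaces
    of matrices, whose neighbourhoods unfold to an entrywise description. *)
Lemma continuous_distP (T : topologicalType) (u : T -> R) (x : T) :
  (forall eps, 0 < eps -> \forall z \near x, `|u x - u z| < eps) <->
  {for x, continuous u}.
Proof. by split=> [H|/cvgrPdist_lt H]; [apply/cvgrPdist_lt | exact: H]. Qed.

Lemma continuous_dot (T : topologicalType) d (f g : T -> 'rV[R]_d) :
  continuous f -> continuous g -> continuous (fun t => dot (f t) (g t)).
Proof.
move=> cf cg.
have cc (h : T -> 'rV[R]_d) i : continuous h -> continuous (fun t => h t 0 i).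
  by move=> ch t; exact: (continuous_comp (ch t) (@coord_continuous R 1 d 0 i (h t))).
rewrite /dot; elim: (index_enum _) => [|i r IH].
  under eq_fun do rewrite big_nil.
  exact: cst_continuous.
under eq_fun do rewrite big_cons.
move=> t; exact: (cvgD (cvgM (cc f i cf t) (cc g i cg t)) (IH t)).
Qed.

(** Freezing the time variable below [s] turns continuity on the half space into
    global continuity, to which the extreme value theorem applies directly. *)
Lemma within_continuous_extend (V : topologicalType) (s : R) (u : R -> V -> R) :
  {within [set z : R * V | s <= z.1], continuous (fun z => u z.1 z.2)} ->
  continuous (fun z : R * V => u (Num.max s z.1) z.2).
Proof.
move=> /subspace_continuousP H z.
have Dz : [set z : R * V | s <= z.1] (Num.max s z.1, z.2).
  by rewrite /= le_max lexx.
have c1 : (fun z : R * V => (Num.max s z.1, z.2)) @ z --> (Num.max s z.1, z.2).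
  have c0 : {for z, continuous (cst s \max (fst : R * V -> R))}.
    have cs : {for z, continuous (cst s : R * V -> R)} by exact: cvg_cst.
    have cf : {for z, continuous (fst : R * V -> R)} by exact: cvg_fst.
    exact: (continuous_max cs cf).
  exact: (cvg_pair c0 cvg_snd).
move=> A HA.
suff : nbhs z ((fun z : R * V => u (Num.max s z.1) z.2) @^-1` A) by [].
have HB := c1 _ (H _ Dz A HA).
have {}HB : nbhs z [set w : R * V | s <= Num.max s w.1 ->
    A (u (Num.max s w.1) w.2)] by exact: HB.
by apply: filterS HB => w /=; apply; rewrite le_max lexx.
Qed.

Lemma compact_cube d (m : R) :
  compact [set x : 'rV[R]_d | forall i, x 0 i \in `[- m, m]].
Proof.
have := @rV_compact R d (fun=> `[- m, m]%classic) (fun=> @segment_compact _ _ _).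
by congr compact; apply/seteqP; split => x /= H i; have := H i.
Qed.

Lemma penalty_continuous (T : topologicalType) d (p n m : T -> R)
    (x y : T -> 'rV[R]_d) (s c delta eps k : R) :
  0 < delta -> (forall z, s <= m z) ->
  continuous p -> continuous n -> continuous m -> continuous x -> continuous y ->
  continuous (fun z => p z - n z
    - c / (m z - s + delta) * dot (x z - y z) (x z - y z)
    - eps * (dot (x z) (x z) + dot (y z) (y z)) - k * (m z - s)).
Proof.
move=> d0 sm cp cn cm cx cy z.
have cxy : continuous (fun z => dot (x z - y z) (x z - y z)).
  by apply: continuous_dot => w; exact: (cvgB (cx w) (cy w)).
have cms w : (fun z => m z - s) @ w --> m w - s by exact: (cvgB (cm w) (cvg_cst _)).
have ctau : (fun z => (m z - s + delta)^-1) @ z --> (m z - s + delta)^-1.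
  apply: cvgV; last exact: (cvgD (cms z) (cvg_cst _)).
  by rewrite gt_eqF // ltr_wpDl // subr_ge0.
have cx2 : {for z, continuous (fun z => dot (x z) (x z))} by exact: continuous_dot.
have cy2 : {for z, continuous (fun z => dot (y z) (y z))} by exact: continuous_dot.
exact: (cvgB (cvgB (cvgB (cvgB (cp z) (cn z)) (cvgM (cvgM (cvg_cst c) ctau) (cxy z)))
  (cvgM (cvg_cst eps) (cvgD cx2 cy2))) (cvgM (cvg_cst k) (cms z))).
Qed.

Lemma doubled_continuous d (P N : R -> 'rV[R]_d -> R) (s c delta eps K : R) :
  0 < delta ->
  {within [set z : R * 'rV[R]_d | s <= z.1], continuous (fun z => P z.1 z.2)} ->
  {within [set z : R * 'rV[R]_d | s <= z.1], continuous (fun z => N z.1 z.2)} ->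
  continuous (fun z : R * 'rV[R]_d * 'rV[R]_d =>
    P (Num.max s z.1.1) z.1.2 - N (Num.max s z.1.1) z.2
    - c / (Num.max s z.1.1 - s + delta) * dot (z.1.2 - z.2) (z.1.2 - z.2)
    - eps * (dot z.1.2 z.1.2 + dot z.2 z.2) - eps * K * (Num.max s z.1.1 - s)).
Proof.
move=> d0 cP cN.
have cfst (z : R * 'rV[R]_d * 'rV[R]_d) : {for z, continuous fst} by exact: cvg_fst.
have cx : continuous (fun z : R * 'rV[R]_d * 'rV[R]_d => z.1.2).
  by move=> z; exact: (continuous_comp (cfst z) cvg_snd).
have cy : continuous (fun z : R * 'rV[R]_d * 'rV[R]_d => z.2).
  by move=> z; exact: cvg_snd.
have ct : continuous (fun z : R * 'rV[R]_d * 'rV[R]_d => z.1.1).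
  by move=> z; exact: (continuous_comp (cfst z) cvg_fst).
have cm : continuous (fun z : R * 'rV[R]_d * 'rV[R]_d => Num.max s z.1.1).
  move=> z; have cs : {for z, continuous (fun=> s)} by exact: cvg_cst.
  exact: (continuous_max cs (ct z)).
have cP' : continuous (fun z : R * 'rV[R]_d * 'rV[R]_d =>
    P (Num.max s z.1.1) z.1.2).
  move=> z; have H := within_continuous_extend cP.
  exact: (continuous_comp (cfst z) (H z.1)).
have cN' : continuous (fun z : R * 'rV[R]_d * 'rV[R]_d =>
    N (Num.max s z.1.1) z.2).
  move=> z; have H := within_continuous_extend cN.
  have c2 : {for z, continuous (fun z : R * 'rV[R]_d * 'rV[R]_d => (z.1.1, z.2))}.
    exact: (cvg_pair (ct z) (cy z)).
  exact: (continuous_comp c2 (H (z.1.1, z.2))).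
have sm (z : R * 'rV[R]_d * 'rV[R]_d) : s <= Num.max s z.1.1.
  by rewrite le_max lexx.
exact: (@penalty_continuous _ _ _ _ _ _ _ s c delta eps (eps * K)
  d0 sm cP' cN' cm cx cy).
Qed.

Lemma is_derive_penalty (a n : R -> R) (a' n' s c delta D E K t : R) :
  0 < t - s + delta -> is_derive t 1 a a' -> is_derive t 1 n n' ->
  is_derive t 1
    (fun r => a r - n r - c / (r - s + delta) * D - E - K * (r - s))
    (a' - n' + c / (t - s + delta) ^+ 2 * D - K).
Proof.
move=> tau0 da dn.
have lin k : is_derive t 1 (fun r : R => r + k) 1 by exact: is_derive_shift.
have dtau : is_derive t 1 (fun r => r - s + delta) 1.
  by under eq_fun do rewrite -addrA; exact: lin.
have dinv : is_derive t 1 (fun r => (r - s + delta)^-1) (- (t - s + delta) ^- 2 * 1).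
  apply: DeriveDef; first by apply: derivableV; rewrite // gt_eqF.
  by rewrite deriveV ?gt_eqF // derive_val.
have -> : (fun r => a r - n r - c / (r - s + delta) * D - E - K * (r - s)) =
  a - n - ((c * D) \*: (fun r => (r - s + delta)^-1)) - cst E
    - (K \*: (fun r => r - s)).
  by apply/funext => r; rewrite !fctE /= /GRing.scale /=; ring.
have H1 := is_deriveB (is_deriveB da dn) (is_deriveZ (c * D) dinv).
have H2 := is_deriveB (is_deriveB H1 (is_derive_cst E t 1)) (is_deriveZ K (lin (- s))).
apply: (is_derive_eq H2).
by rewrite /GRing.scale /=; ring.
Qed.

Lemma dot_le_cube d (k : R) (z : 'rV[R]_d) : 0 <= k -> dot z z <= k ->
  forall i, z 0 i \in `[- (k + 1), k + 1].
Proof.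
move=> k0 zk i; rewrite in_itv /= -ler_norml leNgt; apply/negP => kz.
have : (k + 1) ^+ 2 < `|z 0 i| ^+ 2 by rewrite ltr_pXn2r // nnegrE addr_ge0.
rewrite real_normK ?num_real // => kz2.
have := coord_sqr_le_dot z i; have : 0 <= k ^+ 2 by exact: sqr_ge0.
have -> : k ^+ 2 = (k + 1) ^+ 2 - 2 * k - 1 by ring.
lra.
Qed.

End Continuity.

(** * Consequences of the assumptions on the drift and on the solutions *)

Section Coefficients.
Context {R : realType} {d : nat}.

Lemma powR_small (theta eps : R) : 0 < theta -> 0 < eps ->
  exists2 r, 0 < r & forall a, 0 <= a -> a < r -> a `^ theta < eps.
Proof.
move=> th0 e0; exists (eps `^ theta^-1); first exact: powR_gt0.
move=> a a0 ar; have -> : eps = (eps `^ theta^-1) `^ theta.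
  by rewrite -powRrM mulVf ?gt_eqF // powRr1 // ltW.
by rewrite gt0_ltr_powR // nnegrE // powR_ge0.
Qed.

Lemma par_holder_loc_continuous (theta : R) J (u : R -> 'rV[R]_d -> R) t :
  0 < theta -> par_holder_loc theta J u -> J t -> continuous (u t).
Proof.
move=> th0 hu Jt.
suff H (x : 'rV[R]_d) : {for x, continuous (u t)} by move=> x; exact: H.
(* the cube [- m, m] contains all points at distance at most 1 from [x] *)
pose m := \sum_i `|x 0 i| + 1.
pose K := [set t] `*` [set z : 'rV[R]_d | forall i, z 0 i \in `[- m, m]].
have cK : compact K by exact: (compact_setX (@compact_set1 _ t) (@compact_cube R d m)).
have [|C HC] := hu K cK; first by move=> [r z] [/= -> _]; split.
apply/continuous_distP => eps eps0.
have C0 : 0 < `|C| + 1 by rewrite ltr_wpDl.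
have [r' r'0 Hr] := powR_small th0 (divr_gt0 eps0 C0).
pose r := Num.min r' 1.
have r0 : 0 < r by rewrite lt_min r'0 ltr01.
have rr' : r <= r' by rewrite ge_min lexx.
have r1 : r <= 1 by rewrite ge_min lexx orbT.
have cd : continuous (fun z : 'rV[R]_d => dot (x - z) (x - z)).
  by apply: continuous_dot => z; exact: (cvgB (cvg_cst _) cvg_id).
have r20 : 0 < r ^+ 2 by rewrite exprn_gt0.
have H1 : \forall z \near x, dot (x - z) (x - z) < r ^+ 2.
  have /continuous_distP/(_ _ r20) := cd x.
  apply: (@filterS _ (nbhs x) (nbhs_filter x)) => z /=.
  rewrite subrr {1}/dot big1 => [|i _]; last by rewrite mxE mul0r.
  by rewrite sub0r normrN ger0_norm // dot_ge0.
apply: (@filterS _ (nbhs x) (nbhs_filter x)) H1 => z dz.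
have ez : enorm (x - z) < r.
  by rewrite -(ltr_pXn2r (n := 2)) ?nnegrE ?sqrtr_ge0 ?(ltW r0) // enorm_sqr.
have Kx : K (t, x).
  split => //= i; rewrite in_itv /= -ler_norml /m (bigD1 i) //= -addrA lerDl.
  by rewrite addr_ge0 // sumr_ge0.
have Kz : K (t, z).
  split => //= i; rewrite in_itv /= -ler_norml.
  have xz : `|x 0 i - z 0 i| <= 1.
    apply: le_trans r1; apply: ltW.
    rewrite -(ltr_pXn2r (n := 2)) ?nnegrE ?(ltW r0) // real_normK ?num_real //.
    apply: le_lt_trans dz; have := coord_sqr_le_dot (x - z) i.
    by rewrite !mxE.
  have xm : `|x 0 i| + 1 <= m.
    by rewrite /m (bigD1 i) //= lerD2r lerDl sumr_ge0.
  apply: le_trans xm; rewrite -[z 0 i](subKr (x 0 i)).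
  by rewrite (le_trans (ler_normB _ _)) // lerD2l.
have /= := HC _ _ Kx Kz; rewrite subrr normr0 powR0; last first.
  by rewrite gt_eqF // divr_gt0.
rewrite add0r => H; apply: (le_lt_trans H).
have := Hr _ (sqrtr_ge0 _) (lt_le_trans ez rr').
rewrite ltr_pdivlMr // mulrC; apply: le_lt_trans.
apply: ler_wpM2r; first exact: powR_ge0.
by rewrite (le_trans (ler_norm C)) // lerDl.
Qed.

Lemma par_C12_is_C2 (theta : R) J (u : R -> 'rV[R]_d -> R) t : 0 < theta ->
  par_C12_holder_loc theta J u -> J t -> is_C2 (u t).
Proof.
move=> th0 [[_ du ddu] [hu _ hdu hddu]] Jt; split.
- exact: par_holder_loc_continuous hu Jt.
- by move=> i x; exact: du.
- by move=> i; exact: (par_holder_loc_continuous th0 (hdu i)).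
- by move=> i j x; exact: ddu.
- by move=> i j; exact: (par_holder_loc_continuous th0 (hddu i j)).
Qed.

(** The mean value theorem along the segment from [y] to [x], where the
    derivative is a value of the quadratic form of the Jacobian. *)
Lemma drift_dissipative (theta r0 : R) I (b : R -> 'rV[R]_d -> 'rV[R]_d) t x y :
  0 < theta -> hyp_dissipative theta r0 I b -> I t ->
  dot (b t x - b t y) (x - y) <= r0 * dot (x - y) (x - y).
Proof.
move=> th0 [db hdb jacb] It.
pose e := x - y; pose g h := dot (b t (y + h *: e)) e.
have gE : g = \sum_i (fun h => e 0 i * b t (y + h *: e) 0 i).
  apply/funext => h; rewrite fct_sumE; apply: eq_bigr => i _.
  by rewrite mulrC.
have dg (h : R) : is_derive h 1 g (quad_form (jac b t (y + h *: e)) e).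
  rewrite gE; apply: (@is_derive_eq _ _ _ _ _ _ _
    (\sum_i e 0 i * dot e (grad (fun z => b t z 0 i) (y + h *: e)))).
    apply: is_derive_sum => i.
    have H : is_derive h 1 (fun h => b t (y + h *: e) 0 i)
        (dot e (grad (fun z => b t z 0 i) (y + h *: e))).
      apply: (is_derive_line (F := fun z => b t z 0 i)).
      apply: is_derive_grad; first by move=> j z; exact: db.
      by move=> j; exact: (par_holder_loc_continuous th0 (hdb i j)).
    exact: (is_deriveZ (e 0 i) H).
  apply: eq_bigr => i _; rewrite /dot mulr_sumr; apply: eq_bigr => j _.
  by rewrite !mxE; ring.
have cg : continuous g.
  by move=> h; exact: is_derive_continuous (dg h).
have [c _] := MVT ltr01 (fun h _ => dg h) (continuous_subspaceT cg).
have yx : y + e = x by rewrite /e addrC subrK.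
rewrite /g scale1r scale0r addr0 yx subr0 mulr1.
rewrite -dotNl -dotDl -/e => ->.
by rewrite -enorm_sqr; exact: jacb.
Qed.

(** The local Hoelder bound on the compact segment from [(s, 0)] to [(T, 0)]
    controls the distance to the value at [(s, 0)]. *)
Lemma drift_origin_bounded (theta : R) I (b : R -> 'rV[R]_d -> 'rV[R]_d) (s T : R) :
  0 < theta -> (forall i, par_holder_loc theta I (fun t x => b t x 0 i)) ->
  s <= T -> (forall t, s <= t -> t <= T -> I t) ->
  exists B : R, forall t, s <= t -> t <= T -> dot (b t 0) (b t 0) <= B.
Proof.
move=> th0 hb sT hI.
have cK : compact (`[s, T]%classic `*` [set (0 : 'rV[R]_d)]).
  exact: (compact_setX (@segment_compact _ s T) (@compact_set1 _ (0 : 'rV[R]_d))).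
have bi i : exists Bi : R, forall t, s <= t -> t <= T -> b t 0 0 i ^+ 2 <= Bi.
  have [|C HC] := hb i _ cK.
    by move=> [t z] /= [+ _]; rewrite in_itv /= => /andP[st tT]; split => //; exact: hI.
  exists ((`|b s 0 0 i| + `|C| * ((T - s) `^ (theta / 2))) ^+ 2) => t st tT.
  have Ks : (`[s, T]%classic `*` [set (0 : 'rV[R]_d)]) (s, 0).
    by split => //=; rewrite in_itv /= lexx.
  have Kt : (`[s, T]%classic `*` [set (0 : 'rV[R]_d)]) (t, 0).
    by split => //=; rewrite in_itv /= st.
  have /= := HC _ _ Kt Ks.
  have -> : enorm (0 - 0 : 'rV[R]_d) = 0.
    by rewrite /enorm /dot big1 ?sqrtr0 // => j _; rewrite !mxE subr0 mul0r.
  rewrite (@powR0 _ theta) ?gt_eqF // addr0 => H.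
  rewrite -real_normK ?num_real // lerXn2r ?nnegrE //.
    by rewrite addr_ge0 // mulr_ge0 // powR_ge0.
  rewrite -[b t 0 0 i](subrK (b s 0 0 i)) addrC.
  apply: (le_trans (ler_normD _ _)); rewrite lerD2l; apply: (le_trans H).
  apply: (@le_trans _ _ (`|C| * `|t - s| `^ (theta / 2))).
    by apply: ler_wpM2r; [exact: powR_ge0 | exact: ler_norm].
  apply: ler_wpM2l => //; rewrite ger0_norm ?subr_ge0 //.
  apply: ge0_ler_powR; rewrite ?nnegrE ?subr_ge0 ?lerD2r //.
  by rewrite divr_ge0 // ltW.
have [B HB] := choice bi.
exists (\sum_i B i) => t st tT; apply: ler_sum => i _.
by rewrite -expr2; exact: HB.
Qed.

End Coefficients.

(** * Comparison by doubling the space variable *)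

Section Comparison.
Context {R : realType} {d : nat}.
Variables (Q : R -> 'M[R]_d) (b : R -> 'rV[R]_d -> 'rV[R]_d).

(** The equation [D_t w = A(t) w + sigma <Q grad w, grad w>] at the single point
    [(t, x)]: for [sigma = 0] it is the linear equation, and [sigma^-1 * ln u]
    satisfies it when [u] solves the linear one. The gradient [g] and the Hessian
    [H] enter only through the second-order expansions along lines, which is all
    that a maximum principle uses and which is stable under taking logarithms. *)
Definition quasilinear_at (sigma : R) (w : R -> 'rV[R]_d -> R) (t : R) (x : 'rV[R]_d) :=
  exists g H,
    is_derive t 1 (fun r => w r x)
      (\tr (Q t *m H) + dot (b t x) g + sigma * quad_form (Q t) g) /\
    forall e, jet2 (fun h => w t (x + h *: e)) (dot e g) (quad_form H e).

Lemma is_derive_left_max (g : R -> R) (s t l : R) : s < t ->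
  (forall r, s <= r -> r <= t -> g r <= g t) -> is_derive t 1 g l -> 0 <= l.
Proof.
move=> st gmax [dg E]; rewrite leNgt; apply/negP => l0.
have : (fun h : R => h^-1 *: (g (h *: 1 + t) - g t)) @ 0^' --> l.
  by rewrite -E; exact: dg.
have l0' : 0 < - l by rewrite oppr_gt0.
move=> /cvgrPdist_lt/(_ _ l0') [r /= r0 Hr].
pose h := Num.min r (t - s) / 2.
have m0 : 0 < Num.min r (t - s) by rewrite lt_min r0 subr_gt0.
have h0 : 0 < h by rewrite /h divr_gt0.
have hr : h < r.
  by rewrite /h; have : Num.min r (t - s) <= r by [rewrite ge_min lexx]; lra.
have hs : h < t - s.
  rewrite /h; have : Num.min r (t - s) <= t - s by rewrite ge_min lexx orbT.
  by lra.
have := Hr (- h); rewrite /= sub0r opprK gtr0_norm // oppr_eq0 gt_eqF //.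
move=> /(_ hr isT) /ltr_normlP [+ _].
rewrite /GRing.scale /= mulr1 invrN mulNr.
have := gmax (- h + t); have -> : s <= - h + t by lra.
have -> : - h + t <= t by lra.
move=> /(_ isT isT) gh.
have : 0 <= h^-1 * (g t - g (- h + t)).
  by apply: mulr_ge0; [rewrite invr_ge0 ltW | lra].
rewrite !mulrBr; lra.
Qed.

(** The quadratic penalisation confines the positive values of [F] to a compact
    set. *)
Lemma penalized_max_attained (F : R * 'rV[R]_d * 'rV[R]_d -> R) (s T M eps : R) :
  continuous F -> 0 < eps ->
  (forall t x y, s <= t -> t <= T ->
    F (t, x, y) <= M - eps * (dot x x + dot y y)) ->
  forall t1 x1 y1, s <= t1 -> t1 <= T -> 0 < F (t1, x1, y1) ->
  exists t0 x0 y0, [/\ s <= t0, t0 <= T &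
    forall t x y, s <= t -> t <= T -> F (t, x, y) <= F (t0, x0, y0)].
Proof.
move=> cF e0 HF t1 x1 y1 st1 tT1 F1.
pose k := `|M| / eps.
have k0 : 0 <= k by rewrite divr_ge0 // ltW.
pose cube := [set x : 'rV[R]_d | forall i, x 0 i \in `[- (k + 1), k + 1]].
pose K := `[s, T]%classic `*` cube `*` cube.
have cK : compact K.
  exact: (compact_setX (compact_setX (@segment_compact _ s T)
    (@compact_cube R d (k + 1))) (@compact_cube R d (k + 1))).
have outside t x y : s <= t -> t <= T -> 0 < F (t, x, y) -> K (t, x, y).
  move=> st tT Fp.
  have bound : dot x x + dot y y <= k.
    rewrite ler_pdivlMr //; have := HF t x y st tT; have := ler_norm M; lra.
  have x0 := dot_ge0 x; have y0 := dot_ge0 y.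
  split; [split; first by rewrite /= in_itv /= st |];
    by apply: dot_le_cube => //; lra.
have K1 := outside _ _ _ st1 tT1 F1.
have [|[[t0 x0] y0]] := @compact_EVT_max _ R F K _ cK (continuous_subspaceT cF).
  by exists (t1, x1, y1).
rewrite inE => -[[/= + _] _] Fmax; rewrite in_itv /= => /andP[st0 tT0].
exists t0, x0, y0; split => // t x y st tT.
have [Fp|Fn] := ltP 0 (F (t, x, y)).
  by apply: Fmax; rewrite inE; exact: outside.
by apply: (le_trans Fn); apply: (le_trans (ltW F1)); apply: Fmax; rewrite inE.
Qed.

Section Doubling.
Variables (eta0 Lambda beta B : R).
Variables (s T : R).
Hypothesis sT : s <= T.
Hypothesis Q_sym : forall t, s < t -> t <= T -> (Q t)^T = Q t.
Hypothesis eta0_gt0 : 0 < eta0.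
Hypothesis Q_ge : forall t x, s < t -> t <= T ->
  eta0 * dot x x <= quad_form (Q t) x.
Hypothesis Q_le : forall t x, s < t -> t <= T ->
  quad_form (Q t) x <= Lambda * dot x x.
Hypothesis b_diss : forall t x y, s < t -> t <= T ->
  dot (b t x - b t y) (x - y) <= 0.
Hypothesis b_coercive : forall t x, s < t -> t <= T ->
  dot (b t x) x <= B - beta * dot x x.

(** The equations tested at an interior maximum of the doubled function, with
    [xi = 2 (c / tau) (x - y)]. Monotonicity of the drift discards its
    contribution along [xi]. The gradient terms yield at most
    [- (mu (1 - kappa) - sigma (1 + kappa)) <Q xi, xi>], which absorbs the time
    derivative [c / tau ^ 2 |x - y| ^ 2] of the penalty by the choice of [c]; this
    is where the constant in the exponent comes from. The cross terms between
    [xi] and the confinement cost [kappa^-1 eps ^ 2 |x| ^ 2], which the coercive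
    part [- beta eps |x| ^ 2] of the drift absorbs for small [eps]. *)
Lemma doubling_gap (kappa c sigma mu eps tau t : R) (x y gP gN : 'rV[R]_d)
    (HP HN : 'M[R]_d) :
  0 < kappa -> 0 <= sigma -> 0 <= mu -> 0 <= c -> 0 < eps -> 0 < tau ->
  s < t -> t <= T ->
  0 <= mu * (1 - kappa) - sigma * (1 + kappa) ->
  c <= 4 * c ^+ 2 * eta0 * (mu * (1 - kappa) - sigma * (1 + kappa)) ->
  2 * eps * Lambda * (sigma * (1 + kappa^-1)) <= beta ->
  2 * eps * Lambda * (mu * kappa^-1) <= beta ->
  gP = (2 * (c / tau)) *: (x - y) + (2 * eps) *: x ->
  gN = (2 * (c / tau)) *: (x - y) - (2 * eps) *: y ->
  (forall e, quad_form HP e - quad_form HN e <= 4 * eps * dot e e) ->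
  (\tr (Q t *m HP) + dot (b t x) gP + sigma * quad_form (Q t) gP) -
  (\tr (Q t *m HN) + dot (b t y) gN + mu * quad_form (Q t) gN) +
    c / tau ^+ 2 * dot (x - y) (x - y) <= eps * (4 * d%:R * Lambda + 4 * B).
Proof.
move=> k0 sg0 mu0 c0 e0 tau0 st tT coef0 coef epsx epsy -> -> hess_le.
have Q0 z : 0 <= quad_form (Q t) z.
  apply: le_trans (Q_ge z st tT); apply: mulr_ge0; first exact: ltW.
  exact: dot_ge0.
set xi := (2 * (c / tau)) *: (x - y).
have trace_le : \tr (Q t *m HP) - \tr (Q t *m HN) <= 4 * eps * (d%:R * Lambda).
  have : \tr (Q t *m (HP - HN - (4 * eps)%:M)) <= 0.
    apply: mxtrace_mul_le0; first exact: Q_sym.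
    - move=> z z0; apply: lt_le_trans (Q_ge z st tT); apply: mulr_gt0 => //.
      exact: dot_gt0.
    - move=> z; rewrite !quad_form_add !quad_form_opp quad_form_scalar.
      by have := hess_le z; lra.
  rewrite !mulmxBr !linearB /= mul_mx_scalar linearZ /=.
  have trQ : \tr (Q t) <= d%:R * Lambda.
    by apply: mxtrace_le => z; rewrite enorm_sqr; exact: Q_le.
  have : 4 * eps * \tr (Q t) <= 4 * eps * (d%:R * Lambda).
    by apply: ler_wpM2l => //; rewrite mulr_ge0 // ltW.
  by rewrite /GRing.scale /=; lra.
have drift_le : dot (b t x) (xi + (2 * eps) *: x)
    - dot (b t y) (xi - (2 * eps) *: y) <=
    2 * eps * (B - beta * dot x x) + 2 * eps * (B - beta * dot y y).
  rewrite !dotDr !dotNr !dotZr.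
  have : 2 * (c / tau) * dot (b t x - b t y) (x - y) <= 0.
    apply: mulr_ge0_le0; last exact: b_diss.
    by rewrite mulr_ge0 // divr_ge0 // ltW.
  rewrite dotDl dotNl.
  have : 2 * eps * dot (b t x) x <= 2 * eps * (B - beta * dot x x).
    by apply: ler_wpM2l; [rewrite mulr_ge0 // ltW | exact: b_coercive].
  have : 2 * eps * dot (b t y) y <= 2 * eps * (B - beta * dot y y).
    by apply: ler_wpM2l; [rewrite mulr_ge0 // ltW | exact: b_coercive].
  by rewrite !dotDr !dotNr; lra.
have PQ : sigma * quad_form (Q t) (xi + (2 * eps) *: x) <=
    sigma * (1 + kappa) * quad_form (Q t) xi
    + 2 * eps * (beta * dot x x).
  have : sigma * quad_form (Q t) (xi + (2 * eps) *: x) <=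
      sigma * ((1 + kappa) * quad_form (Q t) xi
        + (1 + kappa^-1) * quad_form (Q t) ((2 * eps) *: x)).
    by apply: ler_wpM2l => //; exact: quad_form_young.
  move=> /le_trans; apply; rewrite mulrDr -!mulrA lerD2l.
  rewrite quad_form_scale.
  apply: (@le_trans _ _ (sigma * ((1 + kappa^-1) *
      ((2 * eps) ^+ 2 * (Lambda * dot x x))))).
    apply: ler_wpM2l => //; apply: ler_wpM2l.
      by rewrite addr_ge0 // invr_ge0 ltW.
    by apply: ler_wpM2l; [exact: sqr_ge0 | exact: Q_le].
  have -> : sigma * ((1 + kappa^-1) * ((2 * eps) ^+ 2 * (Lambda * dot x x))) =
    (2 * eps * dot x x) * (2 * eps * Lambda * (sigma * (1 + kappa^-1))) by ring.
  have -> : 2 * (eps * (beta * dot x x)) = (2 * eps * dot x x) * beta by ring.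
  apply: ler_wpM2l epsx; apply: mulr_ge0; last exact: dot_ge0.
  by rewrite mulr_ge0 // ltW.
have NQ : mu * (1 - kappa) * quad_form (Q t) xi <=
    mu * quad_form (Q t) (xi - (2 * eps) *: y) + 2 * eps * (beta * dot y y).
  have : mu * ((1 - kappa) * quad_form (Q t) xi
        + (1 - kappa^-1) * quad_form (Q t) (- ((2 * eps) *: y))) <=
      mu * quad_form (Q t) (xi - (2 * eps) *: y).
    by apply: ler_wpM2l => //; exact: quad_form_young_lower.
  have -> : quad_form (Q t) (- ((2 * eps) *: y)) =
      (2 * eps) ^+ 2 * quad_form (Q t) y.
    by rewrite -scaleNr quad_form_scale sqrrN.
  have : mu * kappa^-1 * ((2 * eps) ^+ 2 * quad_form (Q t) y) <=
      2 * eps * (beta * dot y y).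
    apply: (@le_trans _ _ (mu * kappa^-1 * ((2 * eps) ^+ 2 * (Lambda * dot y y)))).
      apply: ler_wpM2l; first by rewrite mulr_ge0 // invr_ge0 ltW.
      by apply: ler_wpM2l; [exact: sqr_ge0 | exact: Q_le].
    have -> : mu * kappa^-1 * ((2 * eps) ^+ 2 * (Lambda * dot y y)) =
      (2 * eps * dot y y) * (2 * eps * Lambda * (mu * kappa^-1)) by ring.
    have -> : 2 * eps * (beta * dot y y) = (2 * eps * dot y y) * beta by ring.
    apply: ler_wpM2l epsy; apply: mulr_ge0; last exact: dot_ge0.
    by rewrite mulr_ge0 // ltW.
  have : 0 <= mu * ((2 * eps) ^+ 2 * quad_form (Q t) y).
    by apply: mulr_ge0 => //; apply: mulr_ge0; [exact: sqr_ge0 | exact: Q0].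
  set q := (2 * eps) ^+ 2 * _; set p := quad_form _ xi; lra.
have gap : c / tau ^+ 2 * dot (x - y) (x - y) <=
    (mu * (1 - kappa) - sigma * (1 + kappa)) * quad_form (Q t) xi.
  apply: (@le_trans _ _ ((mu * (1 - kappa) - sigma * (1 + kappa)) *
      (eta0 * dot xi xi))).
    rewrite /xi dotZl dotZr.
    have -> : (mu * (1 - kappa) - sigma * (1 + kappa)) *
      (eta0 * (2 * (c / tau) * (2 * (c / tau) * dot (x - y) (x - y)))) =
      (4 * c ^+ 2 * eta0 * (mu * (1 - kappa) - sigma * (1 + kappa))) *
        (dot (x - y) (x - y) / tau ^+ 2) by field; rewrite gt_eqF.
    rewrite mulrAC -mulrA; apply: ler_wpM2r coef.
    by rewrite divr_ge0 ?dot_ge0 // sqr_ge0.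
  by apply: ler_wpM2l => //; exact: Q_ge.
lra.
Qed.

(** If the conclusion failed, the doubled function
    [P - N - c / (t - s + delta) |x - y| ^ 2 - eps (|x| ^ 2 + |y| ^ 2)
     - eps K (t - s)]
    would have a maximum above [rho], at a time later than [s]. There the first
    and second variations are used along pairs [(e, e')] of directions:
    independent ones determine the two gradients, while along [e = e'] the
    distance [x - y] is constant, so the Hessians satisfy
    [HP - HN <= 4 eps] and the singular penalty leaves no trace. The time
    derivative then contradicts the choice of [K]. The shift [delta > 0] keeps the
    penalty finite at the initial time. *)
Lemma doubling_comparison (kappa c sigma mu eps delta rho K M : R)
    (P N : R -> 'rV[R]_d -> R) :
  0 < kappa -> 0 <= sigma -> 0 <= mu -> 0 <= c -> 0 < eps -> 0 < delta ->
  0 <= rho ->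
  0 <= mu * (1 - kappa) - sigma * (1 + kappa) ->
  c <= 4 * c ^+ 2 * eta0 * (mu * (1 - kappa) - sigma * (1 + kappa)) ->
  2 * eps * Lambda * (sigma * (1 + kappa^-1)) <= beta ->
  2 * eps * Lambda * (mu * kappa^-1) <= beta ->
  4 * d%:R * Lambda + 4 * B < K -> 0 <= K ->
  {within [set z : R * 'rV[R]_d | s <= z.1], continuous (fun z => P z.1 z.2)} ->
  {within [set z : R * 'rV[R]_d | s <= z.1], continuous (fun z => N z.1 z.2)} ->
  (forall t x, s <= t -> P t x <= M) -> (forall t x, s <= t -> - M <= N t x) ->
  (forall x y, P s x - N s y - c / delta * dot (x - y) (x - y)
     - eps * (dot x x + dot y y) <= rho) ->
  (forall t x y, s < t -> t <= T -> P t x <= N t y \/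
     quasilinear_at sigma P t x /\ quasilinear_at mu N t y) ->
  forall x y, P T x - N T y <= rho + c / (T - s + delta) * dot (x - y) (x - y)
    + eps * (dot x x + dot y y) + eps * K * (T - s).
Proof.
move=> k0 sg0 mu0 c0 e0 d0 rho0 coef0 coef epsx epsy HK K0 cP cN PM NM init sol x1 y1.
pose W t x y := P t x - N t y - c / (t - s + delta) * dot (x - y) (x - y)
  - eps * (dot x x + dot y y) - eps * K * (t - s).
suff : W T x1 y1 <= rho by rewrite /W; lra.
rewrite leNgt; apply/negP => W1.
pose V (z : R * 'rV[R]_d * 'rV[R]_d) :=
  let t := Num.max s z.1.1 in W t z.1.2 z.2.
have VE t x y : s <= t -> V (t, x, y) = W t x y.
  by move=> st; rewrite /V /= (max_idPr st).
have cV : continuous V by exact: (@doubled_continuous _ _ P N s c delta eps K d0 cP cN).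
have VM t x y : s <= t -> t <= T -> V (t, x, y) <= 2 * M - eps * (dot x x + dot y y).
  move=> st tT; rewrite VE // /W.
  have := PM t x st; have := NM t y st.
  have : 0 <= c / (t - s + delta) * dot (x - y) (x - y).
    by apply: mulr_ge0 (dot_ge0 _); rewrite divr_ge0 // addr_ge0 ?subr_ge0 // ltW.
  have : 0 <= eps * K * (t - s).
    by rewrite mulr_ge0 ?subr_ge0 // mulr_ge0 // ltW.
  lra.
have V1 : 0 < V (T, x1, y1) by rewrite VE //; lra.
have [t [x [y [st tT Vmax]]]] :=
  penalized_max_attained cV e0 VM sT (lexx T) V1.
have Wmax r z w : s <= r -> r <= T -> W r z w <= W t x y.
  by move=> sr rT; rewrite -!VE //; exact: Vmax.
have Wpos : rho < W t x y by apply: lt_le_trans W1 _; exact: Wmax.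
have {}st : s < t.
  rewrite lt_neqAle st andbT; apply/eqP => ts.
  have := init x y; move: Wpos; rewrite /W -ts subrr add0r mulr0; lra.
set tau := t - s + delta.
have tau0 : 0 < tau by rewrite addr_gt0 // subr_gt0.
have [PN|[[gP [HP [dP jP]]] [gN [HN [dN jN]]]]] := sol t x y st tT.
  move: Wpos; rewrite /W -/tau.
  have : 0 <= c / tau * dot (x - y) (x - y).
    by apply: mulr_ge0 (dot_ge0 _); rewrite divr_ge0 // ltW.
  have : 0 <= eps * K * (t - s).
    by rewrite mulr_ge0 ?subr_ge0 ?(ltW st) // mulr_ge0 // ltW.
  have : 0 <= eps * (dot x x + dot y y).
    by rewrite mulr_ge0 ?addr_ge0 ?dot_ge0 // ltW.
  lra.
have jW e e' : dot e gP - dot e' gN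
      - (2 * (c / tau) * dot (e - e') (x - y)
         + 2 * eps * (dot e x + dot e' y)) = 0 /\
    quad_form HP e - quad_form HN e'
      - 2 * (c / tau * dot (e - e') (e - e') + eps * (dot e e + dot e' e')) <= 0.
  pose q0 := c / tau * dot (x - y) (x - y) + eps * (dot x x + dot y y)
    + eps * K * (t - s).
  pose q1 := 2 * (c / tau) * dot (e - e') (x - y)
    + 2 * eps * (dot e x + dot e' y).
  pose q2 := c / tau * dot (e - e') (e - e') + eps * (dot e e + dot e' e').
  have := jet2_add (jet2_add (jP e) (jet2_scale (-1) (jN e')))
    (jet2_scale (-1) (jet2_quadratic q0 q1 q2)).
  rewrite !mulN1r -/q1 -/q2.
  set f := (X in jet2 X) => jf.
  have fE h : f h = W t (x + h *: e) (y + h *: e').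
    rewrite /f /W /= -/tau /q0 /q1 /q2.
    have -> : x + h *: e - (y + h *: e') = (x - y) + h *: (e - e').
      by rewrite opprD addrACA scalerBr.
    rewrite !(dotDl, dotDr, dotZl, dotZr, dotNl, dotNr).
    rewrite !(dotC x e, dotC y e', dotC x e', dotC y e, dotC y x, dotC e' e); ring.
  apply: jet2_max jf => h.
  by rewrite !fE !scale0r !addr0; exact: Wmax (ltW st) tT.
have gPE : gP = (2 * (c / tau)) *: (x - y) + (2 * eps) *: x.
  apply: dot_inj => e; have [+ _] := jW e 0; rewrite subr0.
  rewrite !dot0l !(dotDr, dotZr, dotNr); lra.
have gNE : gN = (2 * (c / tau)) *: (x - y) - (2 * eps) *: y.
  apply: dot_inj => e; have [+ _] := jW 0 e.
  rewrite sub0r !dot0l !(dotNl, dotDr, dotZr, dotNr); lra.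
have hess_le e : quad_form HP e - quad_form HN e <= 4 * eps * dot e e.
  have [_] := jW e e; rewrite subrr dot0l; lra.
have gap := doubling_gap k0 sg0 mu0 c0 e0 tau0 st tT coef0 coef epsx epsy
  gPE gNE hess_le.
have dW := @is_derive_penalty _ _ _ _ _ s c delta (dot (x - y) (x - y))
  (eps * (dot x x + dot y y)) (eps * K) t tau0 dP dN.
have := is_derive_left_max st _ dW; rewrite -/tau.
move=> /(_ (fun r sr rt => Wmax r x y sr (le_trans rt tT))).
have : 0 < eps * (K - (4 * d%:R * Lambda + 4 * B)).
  by apply: mulr_gt0 => //; rewrite subr_gt0.
move: gap; rewrite !mulrBr; lra.
Qed.

End Doubling.
End Comparison.

(** * The initial time *)

Section InitialLayer.
Context {R : realType} {d : nat}.

(** Off the diagonal the penalty [c / delta * |x - y|^2] beats the oscillation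
    of [F]; near the diagonal continuity suffices; compactness makes one
    [delta] work for all points of the cube outside of which the confinement
    [eps] takes over. *)
Lemma penalized_diff_small (F : 'rV[R]_d -> R) (M c eps rho : R) :
  continuous F -> (forall x, `|F x| <= M) -> 0 < c -> 0 < eps -> 0 < rho ->
  exists2 delta, 0 < delta & forall x y,
    F x - F y - c / delta * dot (x - y) (x - y) - eps * (dot x x + dot y y) <= rho.
Proof.
move=> cF FM c0 e0 rho0.
have M0 : 0 <= M by apply: le_trans (FM 0).
have diff_le x y : F x - F y <= 2 * M.
  by have := ler_norm (F x); have := ler_norm (- F y); rewrite normrN;
     have := FM x; have := FM y; lra.
pose k := 2 * M / eps.
have k0 : 0 <= k by rewrite divr_ge0 ?mulr_ge0 // ltW.
pose cube := [set x : 'rV[R]_d | forall i, x 0 i \in `[- (k + 1), k + 1]].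
have cK : compact (cube `*` cube).
  exact: (compact_setX (@compact_cube R d (k + 1)) (@compact_cube R d (k + 1))).
pose good (delta : R) (z : 'rV[R]_d * 'rV[R]_d) :=
  0 < delta -> F z.1 - F z.2 - c / delta * dot (z.1 - z.2) (z.1 - z.2) <= rho.
have cov := (compact_near_coveringP _).1 cK R (nbhs (0 : R)^'+) good.
have {}cov : \forall delta \near (0 : R)^'+, (cube `*` cube) `<=` good delta.
  apply: cov => -[x y] _.
  have [->|xy] := eqVneq x y.
    have r2 : 0 < rho / 2 by rewrite divr_gt0.
    have Hy := (continuous_distP _ _).2 (cF y) _ r2.
    pose A := [set z | `|F y - F z| < rho / 2].
    exists ((A `*` A), setT).
      split; [by exists (A, A) | exact: (@filterT _ (nbhs (0 : R)^'+) _)].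
    move=> [[x' y'] delta] /= [[/ltr_normlP[Ax _] /ltr_normlP[_ Ay]] _] d0.
    have : 0 <= c / delta * dot (x' - y') (x' - y').
      by apply: mulr_ge0 (dot_ge0 _); rewrite divr_ge0 // ltW.
    by rewrite /=; lra.
  pose D := dot (x - y) (x - y).
  have D0 : 0 < D by rewrite dot_gt0 // subr_eq0.
  have cD : continuous (fun z : 'rV[R]_d * 'rV[R]_d => dot (z.1 - z.2) (z.1 - z.2)).
    by apply: continuous_dot => z; exact: (cvgB cvg_fst cvg_snd).
  have D2 : 0 < D / 2 by rewrite divr_gt0.
  have HD := (continuous_distP _ _).2 (cD (x, y)) _ D2.
  (* below [d1] the penalty alone exceeds the oscillation [2 * M] near [(x, y)] *)
  pose d1 := c * (D / 2) / (2 * M + 1).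
  have M1 : 0 < 2 * M + 1 by lra.
  have d10 : 0 < d1 by rewrite divr_gt0 // mulr_gt0.
  exists ([set z | `|D - dot (z.1 - z.2) (z.1 - z.2)| < D / 2],
          [set delta | delta < d1]).
    by split => //=; exact: nbhs_right_lt.
  move=> [[x' y'] delta] /= [/ltr_normlP[Ad Ad'] dd1] d0.
  have : 2 * M + 1 <= c / delta * dot (x' - y') (x' - y').
    apply: (@le_trans _ _ (c / delta * (D / 2))).
      rewrite mulrAC ler_pdivlMr // mulrC -ler_pdivlMr //.
      exact: ltW.
    apply: ler_wpM2l; first by rewrite divr_ge0 // ltW.
    by lra.
  by have := diff_le x' y'; rewrite /=; lra.
have [delta [d0 Hd]] : exists delta : R, 0 < delta /\ (cube `*` cube) `<=` good delta.
  have /filter_ex[delta [? ?]] : \forall delta \near (0 : R)^'+,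
      0 < delta /\ (cube `*` cube) `<=` good delta.
    near=> delta; split; first by near: delta; exact: nbhs_right_gt.
    by near: delta; exact: cov.
  by exists delta.
exists delta => // x y.
have pen0 : 0 <= c / delta * dot (x - y) (x - y).
  by apply: mulr_ge0 (dot_ge0 _); rewrite divr_ge0 // ltW.
have x0 := dot_ge0 x; have y0 := dot_ge0 y.
have [far|near] := ltP k (dot x x + dot y y).
  move: far; rewrite /k ltr_pdivrMr // mulrC => far.
  by have := diff_le x y; lra.
have : 0 <= eps * (dot x x + dot y y) by rewrite mulr_ge0 ?addr_ge0 // ltW.
have : good delta (x, y) by apply: Hd; split; apply: dot_le_cube => //=; lra.
by move=> /(_ d0) /=; lra.
Unshelve. all: by end_near.
Qed.

End InitialLayer.

(** * Stability of the equation under affine maps and logarithms *)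

Section LogTransform.
Context {R : realType} {d : nat}.
Variables (Q : R -> 'M[R]_d) (b : R -> 'rV[R]_d -> 'rV[R]_d).
Implicit Types (u w : R -> 'rV[R]_d -> R) (t : R) (x : 'rV[R]_d).

Lemma jet2_near (g g' : R -> R) a a' : (\forall h \near (0 : R), g h = g' h) ->
  jet2 g a a' -> jet2 g' a a'.
Proof.
move=> gg' [f df dd]; exists f => //.
have gg2 := near_join gg'.
near=> h.
apply: (@near_eq_is_derive _ _ _ g); last by near: h.
by near: h; exact: gg2.
Unshelve. all: by end_near.
Qed.

Lemma jet2_cst (k : R) : jet2 (cst k) 0 0.
Proof.
have := jet2_quadratic k 0 0; rewrite mulr0; congr jet2.
by apply/funext => h; rewrite !mulr0 !addr0.
Qed.

Lemma quasilinear_affine (k m : R) u t x : quasilinear_at Q b 0 u t x ->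
  quasilinear_at Q b 0 (fun r z => k * u r z + m) t x.
Proof.
move=> [g [H [du ju]]]; exists (k *: g), (k *: H); split.
  have H1 := is_deriveD (is_deriveZ k du) (is_derive_cst m t 1).
  apply: (is_derive_eq H1).
  by rewrite -scalemxAr linearZ /= dotZr /GRing.scale /=; ring.
move=> e; have := jet2_add (jet2_scale k (ju e)) (jet2_cst m).
apply: jet2_eq; rewrite addr0 ?dotZr //.
by rewrite quad_form_scale_mx.
Qed.

Lemma quasilinear_cst (k : R) t x : quasilinear_at Q b 0 (fun _ _ => k) t x.
Proof.
exists 0, 0; split.
  apply: (is_derive_eq (is_derive_cst k t 1)).
  by rewrite mulmx0 mxtrace0 mul0r addr0 add0r dotC dot0l.
move=> e; have := jet2_cst k; apply: jet2_eq; first by rewrite dotC dot0l.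
by rewrite quad_form_mx mulmx0 mul0mx mxE.
Qed.

(** The Hopf-Cole transformation: differentiating the logarithm twice produces
    [- k <Q grad u, grad u> / u ^ 2], which the quadratic term compensates. *)
Lemma quasilinear_ln (k : R) u t x : 0 < k -> 0 < u t x ->
  quasilinear_at Q b 0 u t x ->
  quasilinear_at Q b k^-1 (fun r z => k * ln (u r z)) t x.
Proof.
move=> k0 u0 [g [H [du ju]]].
pose a := (u t x)^-1.
exists ((k * a) *: g), (k *: (a *: H - a ^+ 2 *: (g^T *m g))); split.
  have H1 := is_deriveZ k (is_derive1_comp (is_derive1_ln u0) du).
  apply: (is_derive_eq H1).
  have -> : \tr (Q t *m (k *: (a *: H - a ^+ 2 *: (g^T *m g)))) =
      k * (a * \tr (Q t *m H) - a ^+ 2 * quad_form (Q t) g).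
    rewrite -scalemxAr mxtraceZ mulmxBr linearB /= -!scalemxAr !mxtraceZ.
    by rewrite mulmxA [\tr (_ *m g)]mxtrace_mulC mulmxA quad_form_mx -trace_mx11.
  by rewrite quad_form_scale dotZr /GRing.scale /= -/a; field; rewrite gt_eqF.
move=> e; have p0 : 0 < u t (x + 0 *: e) by rewrite scale0r addr0.
have := jet2_scale k (jet2_ln p0 (ju e)).
apply: jet2_eq; rewrite scale0r addr0 -/a.
  by rewrite dotZr; ring.
rewrite quad_form_scale_mx quad_form_add quad_form_opp !quad_form_scale_mx.
by rewrite quad_form_rank1; ring.
Qed.

Lemma quasilinear_max_ln (k eta : R) u t x : 0 < k -> 0 < eta -> eta < u t x ->
  quasilinear_at Q b 0 u t x ->
  quasilinear_at Q b k^-1 (fun r z => k * ln (Num.max (u r z) eta)) t x.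
Proof.
move=> k0 eta0 ut su.
have [g [H [dw jw]]] := quasilinear_ln k0 (lt_trans eta0 ut) su.
have above (f : R -> R) (r l : R) : is_derive r 1 f l -> eta < f r ->
    \forall z \near r, eta < f z.
  move=> [df _] fr.
  have cf : {for r, continuous f}.
    by exact: (is_derive_continuous (DeriveDef df erefl)).
  exact: (cvgr_gt (f r) cf eta fr).
have [g0 [H0 [du ju]]] := su.
exists g, H; split.
  apply: near_eq_is_derive dw; have := above _ _ _ du ut.
  by apply: filterS => r ur; rewrite max_l // ltW.
move=> e; apply: jet2_near (jw e).
have [f df _] := ju e.
have df0 := nbhs_singleton df.
have u0 : eta < u t (x + 0 *: e) by rewrite scale0r addr0.
have := above _ _ _ df0 u0.
by apply: filterS => r ur; rewrite max_l // ltW.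
Qed.

End LogTransform.

(** * The Harnack inequality *)

Section Harnack.
Context {R : realType} {d : nat}.

Lemma le_of_le_addM (x y C eps0 : R) : 0 < eps0 ->
  (forall eps, 0 < eps -> eps <= eps0 -> x <= y + eps * C) -> x <= y.
Proof.
move=> e0 H; rewrite leNgt; apply/negP => yx.
pose C' := `|C| + 1.
have C0 : 0 < C' by rewrite ltr_wpDl.
pose e := Num.min eps0 ((x - y) / 2 / C').
have e1 : 0 < e by rewrite lt_min e0 !divr_gt0 // subr_gt0.
have := H e e1; rewrite ge_min lexx => /(_ isT).
have : e * C <= e * C'.
  by apply: ler_wpM2l; [exact: ltW | rewrite (le_trans (ler_norm C)) // lerDl].
have : e * C' <= (x - y) / 2 by rewrite -ler_pdivlMr // ge_min lexx orbT.
lra.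
Qed.

Lemma continuous_ln_max (k e a : R) : 0 < e ->
  {for a, continuous (fun a => k * ln (Num.max a e))}.
Proof.
move=> e0.
have c1 : {for a, continuous (fun a : R => a)} by exact: cvg_id.
have ce : {for a, continuous (fun=> e)} by exact: cvg_cst.
have c2 := continuous_max c1 ce.
have c3 : {for Num.max a e, continuous (@ln R)}.
  by apply: continuous_ln; rewrite lt_max e0 orbT.
exact: (cvgM (cvg_cst k) (continuous_comp c2 c3)).
Qed.

Section Solutions.
Variables (Q : R -> 'M[R]_d) (b : R -> 'rV[R]_d -> 'rV[R]_d).
Variables (eta0 Lambda beta B s T : R).
Hypothesis sT : s < T.
Hypothesis eta0_gt0 : 0 < eta0.
Hypothesis Lambda_gt0 : 0 < Lambda.
Hypothesis beta_gt0 : 0 < beta.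
Hypothesis Q_sym : forall t, s < t -> t <= T -> (Q t)^T = Q t.
Hypothesis Q_ge : forall t x, s < t -> t <= T ->
  eta0 * dot x x <= quad_form (Q t) x.
Hypothesis Q_le : forall t x, s < t -> t <= T ->
  quad_form (Q t) x <= Lambda * dot x x.
Hypothesis b_diss : forall t x y, s < t -> t <= T ->
  dot (b t x - b t y) (x - y) <= 0.
Hypothesis b_coercive : forall t x, s < t -> t <= T ->
  dot (b t x) x <= B - beta * dot x x.

(** The part of the notion of bounded classical solution that is invariant under
    change of sign and sufficient for the comparison. *)
Definition bounded_solution (M : R) (u : R -> 'rV[R]_d -> R) :=
  [/\ {within [set z : R * 'rV[R]_d | s <= z.1], continuous (fun z => u z.1 z.2)},
      forall t x, s <= t -> `|u t x| <= M &
      forall t x, s < t -> quasilinear_at Q b 0 u t x].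

Let K : R := `|4 * d%:R * Lambda + 4 * B| + 1.

Let K_gt : 4 * d%:R * Lambda + 4 * B < K.
Proof. by rewrite /K; have := ler_norm (4 * d%:R * Lambda + 4 * B); lra. Qed.

Let K_ge0 : 0 <= K.
Proof. by rewrite addr_ge0. Qed.

(** The weak maximum principle, as the doubling comparison of the zero solution
    with [v], without penalty on [x - y]. *)
Lemma solution_ge0 (M : R) v : bounded_solution M v -> (forall x, 0 <= v s x) ->
  forall x, 0 <= v T x.
Proof.
move=> [cv vM sv] v0 x.
suff : - v T x <= 0 by rewrite oppr_le0.
apply: (@le_of_le_addM _ _ (dot (0 : 'rV[R]_d) 0 + dot x x + K * (T - s)) 1) => // eps e0 _.
have M0 : 0 <= M by apply: le_trans (vM s 0 (lexx s)).
pose P0 (_ : R) (_ : 'rV[R]_d) : R := 0.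
have cmp : P0 T 0 - v T x <= 0 + 0 / (T - s + 1) * dot (0 - x) (0 - x)
    + eps * (dot (0 : 'rV[R]_d) 0 + dot x x) + eps * K * (T - s).
  apply: (@doubling_comparison R d Q b eta0 Lambda beta B s T (ltW sT) Q_sym
    eta0_gt0 Q_ge Q_le b_diss b_coercive 1 0 0 0 eps 1 0 K M P0 v) => //.
  - by lra.
  - by rewrite mul0r mulr0 ltW.
  - by rewrite mul0r mulr0 ltW.
  - by apply: continuous_subspaceT => z; exact: cvg_cst.
  - by move=> t z st; have := vM t z st; rewrite ler_norml => /andP[].
  - move=> z w; rewrite !mul0r subr0 sub0r.
    have : 0 <= eps * (dot z z + dot w w) by rewrite mulr_ge0 ?addr_ge0 ?dot_ge0 ?ltW.
    by have := v0 w; lra.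
  - move=> t z w st tT; right; split; first exact: quasilinear_cst.
    exact: sv.
move: cmp; rewrite /P0 !mul0r addr0 sub0r; lra.
Qed.

(** The doubling comparison for [p * ln u] and [ln v], both regularised at the
    level [eta]: the maximum with [eta] gives a meaning to the logarithm where
    [u] is small or negative, and there the comparison is trivial. The two
    logarithms satisfy the quasilinear equation with coefficients [p^-1] and [1],
    and the gap [1 - p^-1] pays for the time derivative of the penalty with
    [c = 1 / (4 eta0 A)], where [A] tends to [1 - p^-1]. *)
Lemma regularised_harnack (M : R) u v (p eta : R) : 1 < p -> 0 < eta ->
  bounded_solution M u -> bounded_solution M v -> continuous (u s) ->
  (forall x, v s x = `|u s x| `^ p) -> (forall t x, s < t -> t <= T -> 0 <= v t x) ->
  forall x y, p * ln (Num.max (u T x) eta) - ln (v T y + eta `^ p) <=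
    p * dot (x - y) (x - y) / (4 * (p - 1) * eta0 * (T - s)).
Proof.
move=> p1 eta_gt0 [cu uM su] [cv vM sv] cus v_init v_ge0 x y.
have p0 : 0 < p by lra.
have pV0 : 0 < p^-1 by rewrite invr_gt0.
have pV1 : p^-1 < 1 by rewrite invf_lt1.
have etap : 0 < eta `^ p by exact: powR_gt0.
pose P t z := p * ln (Num.max (u t z) eta).
(* on nonnegative [v] the maximum is [v + eta ^ p]; half the level keeps [N]
   bounded below at all times while leaving [v + eta ^ p] strictly above it *)
pose N t z := 1 * ln (Num.max (1 * v t z + eta `^ p) (eta `^ p / 2)).
have max_gt0 (a : R) : 0 < Num.max a eta by rewrite lt_max eta_gt0 orbT.
set X := p * ln _ - _; set D := dot (x - y) (x - y).
have Ts : 0 < T - s by rewrite subr_gt0.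
(* [kappa] is the Young parameter; the bound keeps [A > 0] below, and letting
   [kappa] tend to 0 gives the sharp constant *)
suff main (kappa : R) : 0 < kappa -> kappa <= (1 - p^-1) / (2 * (1 + p^-1)) ->
    X * (4 * eta0 * (T - s) * ((1 - kappa) - p^-1 * (1 + kappa))) <= D.
  have : X * (4 * eta0 * (T - s) * (1 - p^-1)) <= D.
    apply: (@le_of_le_addM _ _ (X * (4 * eta0 * (T - s) * (1 + p^-1)))
      ((1 - p^-1) / (2 * (1 + p^-1)))).
      by rewrite divr_gt0 ?subr_gt0 // mulr_gt0 // addr_gt0.
    by move=> kappa k0 k1; have := main kappa k0 k1; lra.
  rewrite -ler_pdivlMr; last by rewrite !mulr_gt0 // subr_gt0.
  move=> /le_trans; apply; rewrite le_eqVlt; apply/orP; left; apply/eqP.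
  by field; rewrite ?gt_eqF // ?subr_gt0.
move=> k0 kle.
pose A : R := (1 - kappa) - p^-1 * (1 + kappa).
have A0 : 0 < A.
  have : kappa * (1 + p^-1) <= (1 - p^-1) / 2.
    by rewrite -ler_pdivlMr ?addr_gt0 // -mulrA -invfM.
  by rewrite /A; have : 0 < 1 - p^-1 by [rewrite subr_gt0]; lra.
pose c := (4 * eta0 * A)^-1.
have c0 : 0 < c by rewrite invr_gt0 !mulr_gt0.
suff XD : X <= c / (T - s) * D.
  rewrite -ler_pdivlMr ?mulr_gt0 //; apply: (le_trans XD).
  rewrite le_eqVlt; apply/orP; left; apply/eqP; rewrite /c -/A.
  by field; rewrite !gt_eqF.
have e20 : 0 < eta `^ p / 2 by rewrite divr_gt0.
have NE t z : 0 <= v t z -> N t z = ln (v t z + eta `^ p).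
  move=> vp; rewrite /N !mul1r max_l //; lra.
have XE : X = P T x - N T y by rewrite NE // v_ge0.
pose M' : R := `|p * ln (Num.max M eta)| + `|ln (eta `^ p / 2)|.
have PM t z : s <= t -> P t z <= M'.
  move=> st; apply: (@le_trans _ _ (p * ln (Num.max M eta))).
    rewrite ler_pM2l // ler_ln ?posrE //.
    rewrite ge_max !le_max lexx orbT andbT.
    by rewrite (le_trans (ler_norm _) (uM t z st)).
  by rewrite /M' (le_trans (ler_norm _)) // lerDl.
have NM t z : s <= t -> - M' <= N t z.
  move=> st; apply: (@le_trans _ _ (ln (eta `^ p / 2))).
    rewrite lerNl /M' (le_trans (ler_norm _)) // normrN lerDr //.
  by rewrite /N mul1r ler_ln ?posrE ?lt_max ?e20 ?orbT // le_max lexx orbT.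
have cPN : {within [set z : R * 'rV[R]_d | s <= z.1], continuous (fun z => P z.1 z.2)} /\
    {within [set z : R * 'rV[R]_d | s <= z.1], continuous (fun z => N z.1 z.2)}.
  split => z.
    exact: (continuous_comp (cu z) (@continuous_ln_max p eta _ eta_gt0)).
  have ca : {for v z.1 z.2, continuous (fun a : R => 1 * a + eta `^ p)}.
    have ci : {for v z.1 z.2, continuous (fun a : R => a)} by exact: cvg_id.
    exact: (cvgD (cvgMr ci) (cvg_cst (eta `^ p))).
  exact: (continuous_comp (continuous_comp (cv z) ca) (@continuous_ln_max 1 (eta `^ p / 2) _ e20)).
case: cPN => cP cN.
pose F z := p * ln (Num.max `|u s z| eta).
have cF : continuous F.
  move=> z; have ca : {for u s z, continuous (fun a : R => `|a|)}.
    exact: norm_continuous.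
  exact: (continuous_comp (continuous_comp (cus z) ca)
    (@continuous_ln_max p eta _ eta_gt0)).
have FM z : `|F z| <= `|p * ln eta| + `|p * ln (Num.max M eta)|.
  have F1 : p * ln eta <= F z.
    by rewrite ler_pM2l // ler_ln ?posrE // le_max lexx orbT.
  have F2 : F z <= p * ln (Num.max M eta).
    rewrite ler_pM2l // ler_ln ?posrE // ge_max !le_max lexx orbT andbT.
    by rewrite uM.
  rewrite ler_norml; have := ler_norm (- (p * ln eta)); rewrite normrN.
  have := ler_norm (p * ln (Num.max M eta)).
  have := normr_ge0 (p * ln eta); have := normr_ge0 (p * ln (Num.max M eta)).
  by move=> ? ? ? ?; apply/andP; split; lra.
have init z w : P s z - N s w <= F z - F w.
  apply: lerB.
    rewrite ler_pM2l // ler_ln ?posrE // ge_max !le_max lexx orbT andbT.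
    by rewrite ler_norm.
  rewrite NE ?v_init ?powR_ge0 // /F -ln_powR ler_ln ?posrE ?powR_gt0 //.
    have [_|_] := leP `|u s w| eta; first by rewrite lerDr powR_ge0.
    by rewrite lerDl ltW.
  by rewrite ltr_wpDl // powR_ge0.
pose eps0 := beta / (2 * Lambda * (1 + kappa^-1)).
have kV0 : 0 < kappa^-1 by rewrite invr_gt0.
have eps00 : 0 < eps0 by rewrite divr_gt0 // !mulr_gt0 // addr_gt0.
apply: (@le_of_le_addM _ _ (1 + (dot x x + dot y y) + K * (T - s)) eps0) => //.
move=> eps e0 ele.
have eps_le r : r <= 1 + kappa^-1 -> 2 * eps * Lambda * r <= beta.
  move=> rle; move: ele; rewrite /eps0 ler_pdivlMr; last by rewrite !mulr_gt0 // addr_gt0.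
  apply: le_trans.
  have -> : eps * (2 * Lambda * (1 + kappa^-1)) = 2 * eps * Lambda * (1 + kappa^-1).
    by ring.
  by apply: ler_wpM2l => //; rewrite !mulr_ge0 // ltW.
have [delta d0 Hdelta] := penalized_diff_small cF FM c0 e0 e0.
have : P T x - N T y <= eps + c / (T - s + delta) * D
    + eps * (dot x x + dot y y) + eps * K * (T - s).
  apply: (@doubling_comparison R d Q b eta0 Lambda beta B s T (ltW sT) Q_sym
    eta0_gt0 Q_ge Q_le b_diss b_coercive kappa c p^-1 1 eps delta eps K M' P N)
    => //.
  - exact: ltW.
  - exact: ltW.
  - exact: ltW.
  - by rewrite mul1r -/A ltW.
  - rewrite mul1r -/A /c le_eqVlt; apply/orP; left; apply/eqP.
    by field; rewrite !gt_eqF.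
  - apply: eps_le; rewrite -[leRHS]mul1r; apply: ler_wpM2r; last exact: ltW.
    by rewrite addr_ge0 // ltW.
  - by apply: eps_le; rewrite mul1r lerDr.
  - by move=> z w; have := Hdelta z w; have := init z w; lra.
  - move=> t z w st tT; have [ule|ugt] := leP (u t z) eta.
      left; rewrite /P max_r // NE ?v_ge0 // -ln_powR ler_ln ?posrE //.
        by rewrite lerDr v_ge0.
      by rewrite ltr_wpDl // v_ge0.
    right; split.
      by apply: quasilinear_max_ln => //; exact: su.
    have vp : eta `^ p / 2 < 1 * v t w + eta `^ p.
      by have := v_ge0 t w st tT; lra.
    have := @quasilinear_max_ln R d Q b 1 (eta `^ p / 2)
      (fun r z => 1 * v r z + eta `^ p) t w ltr01 e20 vp
      (quasilinear_affine 1 (eta `^ p) (sv t w st)).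
    by rewrite invr1.
rewrite -XE => /le_trans; apply.
have : c / (T - s + delta) * D <= c / (T - s) * D.
  apply: ler_wpM2r; first exact: dot_ge0.
  apply: ler_wpM2l; first exact: ltW.
  by rewrite lef_pV2 ?posrE //; lra.
lra.
Qed.

(** Exponentiate, then let the level [eps = eta ^ p] tend to 0. *)
Lemma harnack_gt0 (M : R) u v (p : R) : 1 < p ->
  bounded_solution M u -> bounded_solution M v -> continuous (u s) ->
  (forall x, v s x = `|u s x| `^ p) -> (forall t x, s < t -> t <= T -> 0 <= v t x) ->
  forall x y, 0 < u T x -> u T x `^ p <= v T y *
    expR (p * dot (x - y) (x - y) / (4 * (p - 1) * eta0 * (T - s))).
Proof.
move=> p1 hu hv cus v_init v_ge0 x y ux.
have p0 : 0 < p by lra.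
set E := p * _ / _.
apply: (@le_of_le_addM _ _ (expR E) 1) => // eps e0 _.
pose eta := eps `^ p^-1.
have eta_gt0 : 0 < eta by exact: powR_gt0.
have etap : eta `^ p = eps by rewrite -powRrM mulVf ?gt_eqF // powRr1 // ltW.
have := regularised_harnack p1 eta_gt0 hu hv cus v_init v_ge0 x y.
rewrite etap -/E -ln_powR lerBlDl => H.
have m0 : 0 < Num.max (u T x) eta by rewrite lt_max ux.
have ve : 0 < v T y + eps by rewrite ltr_wpDl // v_ge0.
rewrite -mulrDl; apply: (@le_trans _ _ (Num.max (u T x) eta `^ p)).
  by apply: ge0_ler_powR; rewrite ?nnegrE ?(ltW p0) ?(ltW ux) ?(ltW m0) // le_max lexx.
rewrite -[leLHS]lnK ?posrE ?powR_gt0 // -[v T y + eps]lnK ?posrE //.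
by rewrite -expRD ler_expR.
Qed.

End Solutions.

Lemma bounded_classical_solution_bounded theta Q b (s : R) (f : 'rV[R]_d -> R) u :
  0 < theta -> bounded_classical_solution theta Q b s f u ->
  exists M, bounded_solution Q b s M u.
Proof.
move=> th0 [cu bu hu eq_u _].
have [M0 [_ HM]] := bu.
exists (M0 + 1); split => //.
  by move=> t x st; apply: (HM (M0 + 1) _ (t, x)) => //=; rewrite ltrDl.
move=> t x st; exists (grad (u t) x), (hess (u t) x).
have Jt : `]s, +oo[%classic t by rewrite /= in_itv /= st.
split; last by move=> e; apply: jet2_line; exact: par_C12_is_C2 hu Jt.
rewrite mul0r addr0; have := eq_u t x st; rewrite /elliptic_op => <-.
have [[du _ _] _] := hu.
by rewrite /dt derive1E; apply: derivableP; exact: du.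
Qed.

Lemma bounded_solution_le Q b (s M M' : R) u : M <= M' ->
  bounded_solution Q b s M u -> bounded_solution Q b s M' u.
Proof.
by move=> MM' [cu uM su]; split => // t x st; exact: le_trans (uM t x st) MM'.
Qed.

Lemma bounded_solution_opp Q b (s M : R) u : bounded_solution Q b s M u ->
  bounded_solution Q b s M (fun t x => - u t x).
Proof.
move=> [cu uM su]; split.
- by move=> z; exact: (cvgN (cu z)).
- by move=> t x st; rewrite normrN uM.
- move=> t x st; have := quasilinear_affine (-1) 0 (su t x st).
  by congr quasilinear_at; apply/funext => r; apply/funext => z; rewrite mulN1r addr0.
Qed.

Lemma continuous_norm_powR (p : R) : 0 < p -> continuous (fun a : R => `|a| `^ p).
Proof.
move=> p0 a; have [->|a0] := eqVneq a 0.
  apply/continuous_distP => eps e0; rewrite normr0 powR0 ?gt_eqF //.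
  have [r r0 Hr] := powR_small p0 e0.
  exists r => //= z; rewrite /ball /= sub0r normrN => zr.
  by rewrite sub0r normrN ger0_norm ?powR_ge0 // Hr.
have ca : {for `|a|, continuous (fun c : R => c `^ p)}.
  apply: differentiable_continuous; apply/derivable1_diffP.
  by apply: derivable_powR; rewrite in_itv /= normr_gt0 a0.
exact: (continuous_comp (@norm_continuous _ _ a) ca).
Qed.

Lemma is_Cb_norm_powR (f : 'rV[R]_d -> R) (p : R) : 0 < p -> is_Cb f ->
  is_Cb (fun z => `|f z| `^ p).
Proof.
move=> p0 [cf [M [_ HM]]]; split.
  move=> z; have ca : {for f z, continuous (fun a : R => `|a| `^ p)}.
    exact: continuous_norm_powR.
  exact: (continuous_comp (cf z) ca).
exists ((M + 1) `^ p); split; first exact: num_real.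
move=> c cM z _ /=; rewrite ger0_norm ?powR_ge0 //; apply: le_trans (ltW cM).
have fM : `|f z| <= M + 1 by apply: HM => //; rewrite ltrDl.
by apply: ge0_ler_powR; rewrite ?nnegrE ?(ltW p0) // (le_trans _ fM).
Qed.

End Harnack.

Theorem proposition3p6 (R : realType) (d : nat) (I : set R)
    (Q : R -> 'M[R]_d) (b : R -> 'rV[R]_d -> 'rV[R]_d)
    (theta eta0 Lambda a gamma r0 : R) (phi : 'rV[R]_d -> R)
    (G : R -> R -> ('rV[R]_d -> R) -> 'rV[R]_d -> R)
    (hd : (0 < d)%N)
    (hI : open_right_halfline I)
    (htheta : 0 < theta /\ theta < 1)
    (hreg : hyp_regular theta I Q b)
    (heta0 : 0 < eta0) (hLambda : eta0 < Lambda)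
    (hell : hyp_elliptic eta0 Lambda I Q)
    (ha : 0 < a) (hgamma : 0 < gamma)
    (hlyap : hyp_lyapunov phi a gamma I Q b)
    (hr0 : r0 < 0)
    (hdiss : hyp_dissipative theta r0 I b)
    (hG : evolution_operator theta I Q b G)
    (f : 'rV[R]_d -> R) (hf : is_Cb f)
    (p : R) (hp : 1 < p)
    (s t : R) (hs : I s) (ht : I t) (hst : s < t)
    (x y : 'rV[R]_d) :
  `|G t s f x| `^ p <=
    G t s (fun z => `|f z| `^ p) y *
      expR (p * enorm (x - y) ^+ 2 / (4 * (p - 1) * eta0 * (t - s))).
Proof.
have [th0 _] := htheta.
have p0 : 0 < p by lra.
have hI' r : s <= r -> I r.
  have [l Il] := hI; move: hs; rewrite Il /= !in_itv /= !andbT => ls sr.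
  exact: lt_le_trans ls sr.
have hIt r : s < r -> I r by move=> /ltW; exact: hI'.
have Q_sym r : s < r -> r <= t -> (Q r)^T = Q r.
  by move=> sr _; have [] := hell r (hIt r sr).
have Q_ge r z : s < r -> r <= t -> eta0 * dot z z <= quad_form (Q r) z.
  move=> sr _; have [_ /(_ z)[+ _]] := hell r (hIt r sr).
  by rewrite enorm_sqr.
have Q_le r z : s < r -> r <= t -> quad_form (Q r) z <= Lambda * dot z z.
  move=> sr _; have [_ /(_ z)[_ +]] := hell r (hIt r sr).
  by rewrite enorm_sqr.
have b_mono r z w : I r -> dot (b r z - b r w) (z - w) <= r0 * dot (z - w) (z - w).
  by move=> Ir; exact: (drift_dissipative _ _ th0 hdiss Ir).
have b_diss r z w : s < r -> r <= t -> dot (b r z - b r w) (z - w) <= 0.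
  move=> sr _; apply: (le_trans (b_mono r z w (hIt r sr))).
  by apply: mulr_le0_ge0; [exact: ltW | exact: dot_ge0].
have [B0 HB0] : exists B0, forall r, s <= r -> r <= t -> dot (b r 0) (b r 0) <= B0.
  have [_ hb] := hreg.
  by apply: (drift_origin_bounded th0 hb (ltW hst)) => r sr _; exact: hI'.
(* dissipativity at the pair [(z, 0)] makes the drift coercive: half of
   [- r0 |z| ^ 2] absorbs [<b(r, 0), z>] *)
pose beta := - r0 / 2; pose B := (- r0)^-1 * B0 / 2.
have b_coercive r z : s < r -> r <= t -> dot (b r z) z <= B - beta * dot z z.
  move=> sr rt; have := b_mono r z 0 (hIt r sr); rewrite !subr0 dotDl dotNl.
  have nr0 : 0 < - r0 by rewrite oppr_gt0.
  have := dot_young (b r 0) z nr0.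
  have : (- r0)^-1 * dot (b r 0) (b r 0) <= (- r0)^-1 * B0.
    by apply: ler_wpM2l; [rewrite invr_ge0 ltW | exact: HB0 (ltW sr) rt].
  by rewrite /B /beta; lra.
have beta_gt0 : 0 < beta by rewrite divr_gt0 // oppr_gt0.
have Lambda_gt0 : 0 < Lambda by exact: lt_trans heta0 hLambda.
set g := fun z => `|f z| `^ p.
have solf := hG s f hs hf.
have solg := hG s g hs (is_Cb_norm_powR p0 hf).
have [Mf hu] := bounded_classical_solution_bounded th0 solf.
have [Mg hv] := bounded_classical_solution_bounded th0 solg.
pose M := Num.max Mf Mg.
have {}hu : bounded_solution Q b s M (fun r => G r s f).
  by apply: bounded_solution_le hu; rewrite le_max lexx.
have {}hv : bounded_solution Q b s M (fun r => G r s g).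
  by apply: bounded_solution_le hv; rewrite le_max lexx orbT.
have uf z : G s s f z = f z by have [_ _ _ _] := solf.
have vg z : G s s g z = g z by have [_ _ _ _] := solg.
have v_ge0 r z : s < r -> r <= t -> 0 <= G r s g z.
  move=> sr rt.
  apply: (@solution_ge0 R d Q b eta0 Lambda beta B s r sr heta0 beta_gt0 _ _ _ _ _ M
    (fun r => G r s g)) => //.
  - by move=> q sq qr; apply: Q_sym => //; exact: le_trans qr rt.
  - by move=> q w sq qr; apply: Q_ge => //; exact: le_trans qr rt.
  - by move=> q w sq qr; apply: Q_le => //; exact: le_trans qr rt.
  - by move=> q w w' sq qr; apply: b_diss => //; exact: le_trans qr rt.
  - by move=> q w sq qr; apply: b_coercive => //; exact: le_trans qr rt.
  - by move=> w; rewrite vg powR_ge0.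
have [cf _] := hf.
(* applied to [G(., s) f] and to its opposite, which have the same [|u s z|] *)
have hpos u : bounded_solution Q b s M u -> continuous (u s) ->
    (forall z, `|u s z| = `|f z|) -> 0 < u t x -> u t x `^ p <=
    G t s g y * expR (p * enorm (x - y) ^+ 2 / (4 * (p - 1) * eta0 * (t - s))).
  move=> su cus us ux; rewrite enorm_sqr.
  apply: (@harnack_gt0 R d Q b eta0 Lambda beta B s t hst heta0 Lambda_gt0 beta_gt0
    Q_sym Q_ge Q_le b_diss b_coercive M u (fun r => G r s g)) => //.
  by move=> z; rewrite vg us.
have fE : G s s f = f by apply/funext.
have [u0|u0|u0] := ltgtP (G t s f x) 0.
- rewrite ltr0_norm //.
  apply: (hpos (fun r z => - G r s f z)); rewrite ?oppr_gt0 //.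
  + exact: bounded_solution_opp.
  + by rewrite fE => z; exact: (cvgN (cf z)).
  + by move=> z; rewrite uf normrN.
- rewrite gtr0_norm //; apply: (hpos (fun r => G r s f)) => //.
  + by rewrite fE.
  + by move=> z; rewrite uf.
- rewrite u0 normr0 powR0 ?gt_eqF //; apply: mulr_ge0; last exact: expR_ge0.
  exact: v_ge0.
Qed.
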